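(* Let $M$ be a von Neumann algebra. The following conditions are equivalent: (1) $E(M)=M$; (2) $M=\bigoplus_{k=1}^{n}M_k$ for some $n$, where $M_k$ is a von Neumann factor for every $k=1,\dots,n$. Moreover, if these conditions hold, then the topology $t_c(M)$ coincides with the uniform topology (the operator norm topology on $M$).
   Context: Let $M\subset B(H)$ be a von Neumann algebra on a complex Hilbert space $H$, with identity $\mathbf 1$, commutant $M'$, center $Z(M)$ and projection lattice $P(M)$; for $p\in P(M)$ put $p^\perp=\mathbf 1-p$. Affiliation: a linear subspace $\mathcal D\subset H$ is affiliated with $M$ ($\mathcal D\,\eta\, M$) if $u(\mathcal D)\subset\mathcal D$ for every unitary $u\in M'$. A linear operator $x$ with domain $\mathcal D(x)$ is affiliated with $M$ ($x\,\eta\, M$) if $\mathcal D(x)\,\eta\, M$ and $u(x\xi)=x(u\xi)$ for all $\xi\in\mathcal D(x)$ and all unitaries $u\in M'$. Measurable operators: $\mathcal D$ is strongly dense in $H$ with respect to $M$ if $\mathcal D\,\eta\, M$ and there is a sequence $(p_n)_{n\ge1}$ in $P(M)$ with $p_n\uparrow\mathbf 1$, $p_n(H)\subset\mathcal D$ and $p_n^\perp$ finite in $M$ for all $n$. A closed linear operator $x$ on $H$ is measurable with respect to $M$ if $x\,\eta\, M$ and $\mathcal D(x)$ is strongly dense; $S(M)$ denotes the set of all such operators. A closed linear operator $x$ is locally measurable with respect to $M$ if $x\,\eta\, M$ and there is a sequence $(z_n)$ of central projections of $M$ with $z_n\uparrow\mathbf 1$ and $z_nx\in S(M)$ for all $n$;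 $LS(M)$ denotes the set of all such operators. With strong sum and strong product (closures of the algebraic sum and product) and the adjoint, $LS(M)$ is a $*$-algebra containing $M$ and $S(M)$ as $*$-subalgebras. Central extension: $E(M)$ is the set of all $x\in LS(M)$ for which there is a family $\{z_i\}_{i\in I}$ of mutually orthogonal central projections of $M$ with $\bigvee_{i\in I}z_i=\mathbf 1$ and $z_ix\in M$ for all $i\in I$. It is a $*$-subalgebra of $LS(M)$ with center $S(Z(M))$. Identify $Z(M)$ with $L^\infty(\Omega,\Sigma,\mu)$ and $S(Z(M))$ with $L^0(\Omega,\Sigma,\mu)$ (classes of complex measurable functions), where $(\Omega,\Sigma,\mu)$ is a measure space with the direct sum property: there is a family $\{\Omega_i\}_{i\in J}\subset\Sigma$ with $0<\mu(\Omega_i)<\infty$ such that for each $A\in\Sigma$ with $\mu(A)<\infty$ there are a countable $J_0\subset J$ and a null set $B$ with $A=\bigcup_{i\in J_0}(A\cap\Omega_i)\cup B$; moreover $\mu$ is semifinite (every set of positive measure contains a subset of finite positive measure). For $\varepsilon,\delta>0$ and $A\in\Sigma$ with $\mu(A)<\infty$, let $$W(A,\varepsilon,\delta)=\{f\in L^0(\Omega,\Sigma,\mu): \exists B\in\Sigma,\ B\subseteq A,\ \mu(A\setminus B)\le\delta,\ f\chi_B\in L^\infty(\Omega,\Sigma,\mu),\ \|f\chi_B\|_{L^\infty}\le\varepsilon\}.$$ Topology $t_c(M)$ on $E(M)$: for $x\in E(M)$ let $\|x\|=\inf\{f\in S(Z(M)):|x|\le f\}\in S(Z(M))$. The sets $x+O(A,\varepsilon,\delta)$,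 where $O(A,\varepsilon,\delta)=\{y\in E(M):\|y\|\in W(A,\varepsilon,\delta)\}$, $\varepsilon,\delta>0$, $\mu(A)<\infty$, form a base of neighborhoods of $x$. *)

(* Defs.v *)
From mathcomp Require Import all_boot all_order all_algebra.
From mathcomp Require Import sesquilinear.
From mathcomp Require Import complex.
From mathcomp Require Import all_classical all_reals all_analysis.

Set Implicit Arguments.
Unset Strict Implicit.
Unset Printing Implicit Defensive.

Import Order.TTheory GRing.Theory Num.Theory.
Import numFieldNormedType.Exports.

Local Open Scope classical_set_scope.
Local Open Scope ring_scope.
Local Open Scope complex_scope.

(* The inner product is linear in the first argument and conjugate-linear in
   the second one. *)
Record hilbertType (R : realType) := Hilbert {
  hilbert_sort :> completeNormedModType R[i];
  inner : {dot hilbert_sort for (@Num.conj R[i])};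
  inner_norm : forall v : hilbert_sort, inner v v = `|v| ^+ 2
}.

Section BoundedOperators.
Context {R : realType} {H : hilbertType R}.
Implicit Types (S T p q z : H -> H) (M : set (H -> H)).

Definition bounded_op T : Prop := linear T /\ continuous T.

Definition hnorm (v : H) : R := complex.Re `|v|.

Definition opnorm T : R := sup [set hnorm (T v) | v in [set v | hnorm v <= 1]].

Definition adjoint_pair T S : Prop := forall u v : H, inner H (T u) v = inner H u (S v).

Definition commutant M : set (H -> H) :=
  [set T | bounded_op T /\ forall S, M S -> T \o S = S \o T].

Definition von_neumann M : Prop :=
  [/\ M `<=` bounded_op,
      (forall T, M T -> exists2 S, M S & adjoint_pair T S) &
      commutant (commutant M) = M].

Definition vn_center M : set (H -> H) := M `&` commutant M.

Definition vn_factor M : Prop :=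
  von_neumann M /\
  vn_center M = range (fun (c : R[i]) => (fun v : H => c *: v)).

Definition unitary_op T : Prop :=
  exists S, [/\ adjoint_pair T S, S \o T = id & T \o S = id].

Definition projection M : set (H -> H) :=
  [set p | [/\ M p, p \o p = p & adjoint_pair p p]].

Definition perp p : H -> H := id \- p.

Definition proj_le p q : Prop := range p `<=` range q.

Definition equiv_proj M p q : Prop :=
  exists u u', [/\ M u, M u', adjoint_pair u u', u' \o u = p & u \o u' = q].

Definition finite_proj M p : Prop :=
  projection M p /\
  forall q, projection M q -> proj_le q p -> equiv_proj M q p -> q = p.

Definition sup_one M (I : Type) (p : I -> H -> H) : Prop :=
  forall q, projection M q -> (forall i, proj_le (p i) q) -> q = id.

Definition increases_to_one M (p : nat -> H -> H) : Prop :=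
  (forall n, proj_le (p n) (p n.+1)) /\ sup_one M p.

End BoundedOperators.

(* A possibly unbounded operator is identified with its graph: (xi, eta)
   belongs to x iff xi is in the domain of x and x xi = eta. *)
Definition oper (R : realType) (H : hilbertType R) := set (H * H).

Section UnboundedOperators.
Context {R : realType} {H : hilbertType R}.
Implicit Types (x y a f g h : oper H) (S T p z : H -> H) (M : set (H -> H)).
Implicit Types D : set H.

Definition op_graph T : oper H := [set v | v.2 = T v.1].

Definition domain x : set H := [set xi | exists eta, x (xi, eta)].

Definition linear_op x : Prop :=
  [/\ x (0, 0),
      (forall (c : R[i]) u v, x u -> x v -> x (c *: u + v)) &
      forall xi eta eta', x (xi, eta) -> x (xi, eta') -> eta = eta'].

Definition closed_op x : Prop := linear_op x /\ closed x.

Definition sum_op x y : oper H :=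
  [set v | exists eta zeta,
     [/\ x (v.1, eta), y (v.1, zeta) & v.2 = eta + zeta]].

Definition prod_op x y : oper H :=
  [set v | exists2 eta, y (v.1, eta) & x (eta, v.2)].

Definition strong_sum x y : oper H := closure (sum_op x y).

Definition strong_prod x y : oper H := closure (prod_op x y).

Definition strong_scale (c : R[i]) x : oper H :=
  strong_prod (op_graph (fun v => c *: v)) x.

(* Single-valued exactly when the domain of x is dense. *)
Definition adj_op x : oper H :=
  [set v | forall w, x w -> inner H w.2 v.1 = inner H w.1 v.2].

(* Positivity in R[i] means real and nonnegative. *)
Definition positive_op x : Prop :=
  [/\ linear_op x, adj_op x = x & forall v, x v -> 0 <= inner H v.2 v.1].

Definition op_le x y : Prop :=
  positive_op (strong_sum y (strong_scale (-1) x)).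

Definition is_abs x a : Prop :=
  positive_op a /\ prod_op a a = prod_op (adj_op x) x.

Definition affiliated_subspace M D : Prop :=
  forall u, commutant M u -> unitary_op u -> u @` D `<=` D.

Definition affiliated M x : Prop :=
  affiliated_subspace M (domain x) /\
  forall u, commutant M u -> unitary_op u ->
    forall xi eta, x (xi, eta) -> x (u xi, u eta).

Definition strongly_dense M D : Prop :=
  affiliated_subspace M D /\
  exists p : nat -> H -> H,
    [/\ forall n, projection M (p n),
        increases_to_one M p,
        forall n, range (p n) `<=` D &
        forall n, finite_proj M (perp (p n))].

Definition measurable_op M : set (oper H) :=
  [set x | [/\ closed_op x, affiliated M x & strongly_dense M (domain x)]].

Definition central_proj M : set (H -> H) := projection M `&` vn_center M.

(* In the next two definitions the product of a central projection with x is
   the strong one: the algebraic product has the same domain as x and need not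
   be closed. *)
Definition locally_measurable M : set (oper H) :=
  [set x | [/\ closed_op x, affiliated M x &
    exists z : nat -> H -> H,
      [/\ forall n, central_proj M (z n),
          increases_to_one M z &
          forall n, measurable_op M (strong_prod (op_graph (z n)) x)]]].

Definition central_extension M : set (oper H) :=
  [set x | locally_measurable M x /\
    exists (I : Type) (z : I -> H -> H),
      [/\ forall i, central_proj M (z i),
          (forall i j, i <> j -> z i \o z j = cst 0),
          sup_one M z &
          forall i, (op_graph @` M) (strong_prod (op_graph (z i)) x)]].

(* f is the infimum in S(Z(M)) of the elements of S(Z(M)) dominating |x|. *)
Definition is_central_norm M x f : Prop :=
  exists a, [/\ is_abs x a,
    measurable_op (vn_center M) f,
    (forall g, measurable_op (vn_center M) g -> op_le a g -> op_le f g) &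
    forall h, measurable_op (vn_center M) h ->
      (forall g, measurable_op (vn_center M) g -> op_le a g -> op_le h g) ->
      op_le h f].

End UnboundedOperators.

(* M is unitarily equivalent to the direct sum of the N k: the isometries V k
   identify H with the Hilbert direct sum of the K k, and the elements of M are
   the operators that are block diagonal with k-th block in N k. *)
Definition is_direct_sum (R : realType) (H : hilbertType R)
    (M : set (H -> H)) (n : nat) (K : 'I_n -> hilbertType R)
    (N : forall k, set (K k -> K k)) : Prop :=
  exists V : forall k, K k -> H,
    [/\ forall k, linear (V k),
        (forall k u v, inner H (V k u) (V k v) = inner (K k) u v),
        (forall j k u v, j <> k -> inner H (V j u) (V k v) = 0),
        (forall xi : H, exists u : forall k, K k, xi = \sum_k V k (u k)) &
        M = [set T | bounded_op T /\
               exists t : forall k, K k -> K k,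
                 (forall k, N k (t k)) /\
                 forall k u, T (V k u) = V k (t k u)]].

Definition finite_sum_of_factors (R : realType) (H : hilbertType R)
    (M : set (H -> H)) : Prop :=
  exists (n : nat) (K : 'I_n -> hilbertType R)
         (N : forall k, set (K k -> K k)),
    [/\ (0 < n)%N, forall k, vn_factor (N k) & is_direct_sum M N].

Section FunctionSpaces.
Context {R : realType} {d : measure_display} {Omega : measurableType d}.
Context (mu : {measure set Omega -> \bar R}).
Implicit Types (f : Omega -> R[i]) (A B : set Omega).

Definition direct_sum_property : Prop :=
  exists (J : Type) (Om : J -> set Omega),
    (forall i, [/\ measurable (Om i), (0 < mu (Om i))%E & (mu (Om i) < +oo)%E])
    /\ forall A, measurable A -> (mu A < +oo)%E ->
         exists (J0 : set J) (B : set Omega),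
           [/\ countable J0, measurable B, mu B = 0%E &
               A = \bigcup_(i in J0) (A `&` Om i) `|` B].

Definition semifinite : Prop :=
  forall A, measurable A -> (0 < mu A)%E ->
    exists B, [/\ measurable B, B `<=` A, (0 < mu B)%E & (mu B < +oo)%E].

(* L^0 and L^oo consist of representatives; classes are taken mu-a.e. *)
Definition L0 : set (Omega -> R[i]) :=
  [set f | measurable_fun setT (fun w => complex.Re (f w)) /\
           measurable_fun setT (fun w => complex.Im (f w))].

Definition Linfty_norm f : \bar R :=
  Lnorm mu +oo%E (fun w => (complex.Re `|f w|)%:E).

Definition Linfty : set (Omega -> R[i]) :=
  [set f | L0 f /\ (Linfty_norm f < +oo)%E].

Definition W_set A (eps delta : R) : set (Omega -> R[i]) :=
  [set f | L0 f /\ exists B,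
     [/\ measurable B, B `<=` A, (mu (A `\` B) <= delta%:E)%E,
         Linfty (fun w => f w * \1_B w) &
         (Linfty_norm (fun w => (f w * \1_B w)%R) <= eps%:E)%E]].

Context {H : hilbertType R}.
Implicit Types (M : set (H -> H)) (Phi : oper H -> Omega -> R[i]).

(* Phi is a *-isomorphism of S(Z(M)) onto L^0 that maps Z(M) onto L^oo. *)
Record identification M Phi : Prop := Identification {
  ident_L0 : forall x, measurable_op (vn_center M) x -> L0 (Phi x);
  ident_inj : forall x y,
    measurable_op (vn_center M) x -> measurable_op (vn_center M) y ->
    ae_eq mu setT (Phi x) (Phi y) -> x = y;
  ident_surj : forall f, L0 f ->
    exists2 x, measurable_op (vn_center M) x & ae_eq mu setT (Phi x) f;
  ident_add : forall x y,
    measurable_op (vn_center M) x -> measurable_op (vn_center M) y ->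
    ae_eq mu setT (Phi (strong_sum x y)) (fun w => Phi x w + Phi y w);
  ident_mul : forall x y,
    measurable_op (vn_center M) x -> measurable_op (vn_center M) y ->
    ae_eq mu setT (Phi (strong_prod x y)) (fun w => Phi x w * Phi y w);
  ident_scale : forall (c : R[i]) x, measurable_op (vn_center M) x ->
    ae_eq mu setT (Phi (strong_scale c x)) (fun w => c * Phi x w);
  ident_adj : forall x, measurable_op (vn_center M) x ->
    ae_eq mu setT (Phi (adj_op x)) (fun w => Num.conj (Phi x w));
  ident_Linfty : forall x, measurable_op (vn_center M) x ->
    ((op_graph @` vn_center M) x <-> Linfty (Phi x))
}.

Definition O_set M Phi A (eps delta : R) : set (oper H) :=
  [set y | central_extension M y /\
     exists2 f, is_central_norm M y f & W_set A eps delta (Phi f)].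

Definition tc_nbhs M Phi (x : oper H) : set_system (oper H) :=
  [set U | exists A (eps delta : R),
     [/\ measurable A, (mu A < +oo)%E, 0 < eps, 0 < delta &
         strong_sum x @` O_set M Phi A eps delta `<=` U]].

End FunctionSpaces.

(* Neighbourhoods of T for the operator norm on M, whose elements are seen as
   graphs. *)
Definition opnorm_nbhs (R : realType) (H : hilbertType R) (M : set (H -> H))
    (T : H -> H) : set_system (oper H) :=
  [set U | exists2 eps : R, 0 < eps &
     op_graph @` [set S | M S /\ opnorm (S \- T) < eps] `<=` U].

(* Main.v *)
From HB Require Import structures.
Require Import Defs.
From mathcomp Require Import all_boot all_order all_algebra.
From mathcomp Require Import sesquilinear complex.
From mathcomp Require Import all_classical all_reals all_analysis.
From mathcomp Require Import ess_sup_inf measurable_realfun.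
From mathcomp Require Import ring lra.

Set Implicit Arguments.
Unset Strict Implicit.
Unset Printing Implicit Defensive.

Import Order.TTheory GRing.Theory Num.Theory.
Import numFieldNormedType.Exports.

Local Open Scope classical_set_scope.
Local Open Scope ring_scope.
Local Open Scope complex_scope.

(** Both conditions say that the centre [Z] of [M] is finite dimensional.

    If [Z] contains infinitely many orthogonal nonzero projections [f 1, f 2, ...],
    completed by a central projection [f 0] so that no nonzero vector is killed by
    all of them, then multiplication by [n] on the range of [f n] defines a closed
    operator of [E(M)] which is unbounded ([unbounded_central_extension]). Hence
    [E(M) = M] forces the identity to be a finite sum of minimal central
    projections: otherwise it could be split without end ([identity_atomic]). On
    the range of a minimal central projection [e] every central operator is a
    scalar ([min_central_scalar]): for a self-adjoint central [A] the projection
    onto the kernel of [|A| - A] is central, so it contains [e] or is orthogonal to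
    [e], and [A] has a constant sign on the range of [e]; applied to all [A - l]
    this leaves a single value. Therefore the corners of [M] at the minimal central
    projections are factors, and [M] is their direct sum
    ([finite_sum_of_factors_of_eq]). The square root [|A|] is obtained from an
    iteration converging in norm, and the projections from the parallelogram law.

    Conversely, in a finite direct sum of factors the summands are the minimal
    central projections [e k] ([blocks_atoms]). Given [x] in [E(M)] and a central
    partition [z i] with [z i x] in [M], each [e k] lies below one [z i], so [x] is
    the finite sum of the [e k z i x], an element of [M]
    ([central_extension_atoms]).

    For the topologies, every operator of [S(Z)] is a bounded diagonal operator
    [sum_k c k e k] ([central_measurable]), and the central norm of [Y] in [M] is
    the one with coefficients [c k = |Y e k|] ([central_normP]). Under an
    identification of [S(Z)] with [L^0] the [e k] become indicators of a finite
    partition into sets of positive measure, and by semifiniteness each of these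
    has a part of finite positive measure. Let [A] be the union of these parts and
    [delta] smaller than the measure of each of them: a subset of [A] missing at
    most [delta] still meets every part, so smallness of the central norm on it
    bounds every [|Y e k|], hence [|Y|] ([tc_nbhs_opnorm]). *)

(** * Vectors, inner products and the Cauchy-Schwarz inequality *)

Section RealScalars.
Context {R : realType}.
Implicit Types a b : R.

Lemma realCM a b : (a * b)%:C = a%:C * b%:C :> R[i].
Proof. exact: rmorphM. Qed.

Lemma realCD a b : (a + b)%:C = a%:C + b%:C :> R[i].
Proof. exact: rmorphD. Qed.

Lemma realCB a b : (a - b)%:C = a%:C - b%:C :> R[i].
Proof. exact: rmorphB. Qed.

Lemma realC_conj a : Num.conj (a%:C) = a%:C :> R[i].
Proof. exact: conjc_real. Qed.

Lemma cjM (x y : R[i]) : Num.conj (x * y) = Num.conj x * Num.conj y.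
Proof. exact: rmorphM. Qed.

Lemma cj_div (x y : R[i]) : Num.conj (x / y) = Num.conj x / Num.conj y.
Proof. exact: fmorph_div. Qed.

End RealScalars.

Section LinearMaps.
Context {K : nzRingType} {U V : lmodType K} (T : U -> V).
Hypothesis lT : linear T.

Lemma linD u v : T (u + v) = T u + T v.
Proof. by rewrite -[u]scale1r lT !scale1r. Qed.

Lemma lin0 : T 0 = 0.
Proof. by apply: (addrI (T 0)); rewrite -linD !addr0. Qed.

Lemma linZ a u : T (a *: u) = a *: T u.
Proof. by rewrite -[a *: u]addr0 lT lin0 addr0. Qed.

Lemma linN u : T (- u) = - T u.
Proof. by rewrite -scaleN1r linZ scaleN1r. Qed.

Lemma linB u v : T (u - v) = T u - T v.
Proof. by rewrite linD linN. Qed.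

Lemma lin_sum I (r : seq I) (P : pred I) (F : I -> U) :
  T (\sum_(i <- r | P i) F i) = \sum_(i <- r | P i) T (F i).
Proof. by elim/big_rec2: _ => [|i a b _ <-]; rewrite ?lin0 ?linD. Qed.

End LinearMaps.

Section InnerProduct.
Context {R : realType} {H : hilbertType R}.
Implicit Types (u v w : H) (c : R[i]) (T S : H -> H).

Local Notation ip := (inner H).
Local Notation cj := (@Num.conj R[i]).

Lemma ipDl u v w : ip (u + v) w = ip u w + ip v w.
Proof. by rewrite linearDl. Qed.

Lemma ipDr u v w : ip u (v + w) = ip u v + ip u w.
Proof. by rewrite linearDr. Qed.

Lemma ipZl c u v : ip (c *: u) v = c * ip u v.
Proof. by rewrite linearZl_LR. Qed.

Lemma ipZr c u v : ip u (c *: v) = Num.conj c * ip u v.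
Proof. by rewrite linearZr_LR. Qed.

Lemma ipNl u v : ip (- u) v = - ip u v.
Proof. by rewrite linearNl. Qed.

Lemma ipNr u v : ip u (- v) = - ip u v.
Proof. by rewrite linearNr. Qed.

Lemma ipBl u v w : ip (u - v) w = ip u w - ip v w.
Proof. by rewrite ipDl ipNl. Qed.

Lemma ipBr u v w : ip u (v - w) = ip u v - ip u w.
Proof. by rewrite ipDr ipNr. Qed.

Lemma ip0l v : ip 0 v = 0.
Proof. by rewrite -(scale0r v) ipZl mul0r. Qed.

Lemma ip0r v : ip v 0 = 0.
Proof. by rewrite -(scale0r v) ipZr rmorph0 mul0r. Qed.

Lemma ipC u v : ip u v = Num.conj (ip v u).
Proof. by rewrite (hermC (inner H) u v) expr0 mul1r. Qed.

Lemma ip_suml I (r : seq I) (P : pred I) (F : I -> H) v :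
  ip (\sum_(i <- r | P i) F i) v = \sum_(i <- r | P i) ip (F i) v.
Proof. by elim/big_rec2: _ => [|i a b _ <-]; rewrite ?ip0l ?ipDl. Qed.

Lemma ip_sumr I (r : seq I) (P : pred I) (F : I -> H) v :
  ip v (\sum_(i <- r | P i) F i) = \sum_(i <- r | P i) ip v (F i).
Proof. by elim/big_rec2: _ => [|i a b _ <-]; rewrite ?ip0r ?ipDr. Qed.

Lemma hnormE v : `|v| = (hnorm v)%:C.
Proof. by rewrite /hnorm RRe_real// ger0_real. Qed.

Lemma ip_hnorm v : ip v v = ((hnorm v) ^+ 2)%:C.
Proof. by rewrite inner_norm hnormE rmorphXn. Qed.

Lemma hnorm_ge0 v : 0 <= hnorm v.
Proof. by rewrite -ler0c -hnormE. Qed.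

Lemma hnorm0 : hnorm (0 : H) = 0.
Proof. by apply: complexI; rewrite -hnormE normr0. Qed.

Lemma hnorm_eq0 v : hnorm v = 0 -> v = 0.
Proof. by move=> h; apply/eqP; rewrite -normr_eq0 hnormE h. Qed.

Lemma hnorm_triangle u v : hnorm (u + v) <= hnorm u + hnorm v.
Proof. by have := ler_normD u v; rewrite !hnormE -rmorphD lecR. Qed.

Lemma hnorm_opp v : hnorm (- v) = hnorm v.
Proof. by apply: complexI; rewrite -!hnormE normrN. Qed.

Lemma hnormBC u v : hnorm (u - v) = hnorm (v - u).
Proof. by rewrite -hnorm_opp opprB. Qed.

Lemma hnormZ c v : hnorm (c *: v) = complex.Re `|c| * hnorm v.
Proof.
apply: complexI; rewrite realCM -!hnormE normrZ.
by rewrite RRe_real// ger0_real.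
Qed.

Lemma hnormZr (a : R) v : hnorm (a%:C *: v) = `|a| * hnorm v.
Proof.
by rewrite hnormZ normc_def /= expr0n /= addr0 sqrtr_sqr.
Qed.

Lemma hnorm_sqr v : hnorm v ^+ 2 = complex.Re (ip v v).
Proof. by rewrite ip_hnorm. Qed.

Lemma ip_ge0 v : 0 <= ip v v.
Proof. by rewrite ip_hnorm ler0c sqr_ge0. Qed.

Lemma ip_eq0 v : ip v v = 0 -> v = 0.
Proof.
by rewrite ip_hnorm => /complexI /eqP; rewrite sqrf_eq0 => /eqP /hnorm_eq0.
Qed.

Lemma ip_inj u v : (forall w, ip u w = ip v w) -> u = v.
Proof. by move=> h; apply/subr0_eq/ip_eq0; rewrite ipBl h subrr. Qed.

Lemma ip_injr u v : (forall w, ip w u = ip w v) -> u = v.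
Proof. by move=> h; apply: ip_inj => w; rewrite ipC h -ipC. Qed.

Lemma adjoint_sym T S : adjoint_pair T S -> adjoint_pair S T.
Proof. by move=> h u v; rewrite ipC -h -ipC. Qed.

Lemma hnorm_pythag u v : ip u v = 0 -> hnorm (u + v) ^+ 2 = hnorm u ^+ 2 + hnorm v ^+ 2.
Proof.
move=> h; rewrite !hnorm_sqr ipDl !ipDr h (ipC v u) h rmorph0 addr0 add0r.
by rewrite raddfD.
Qed.

Lemma parallelogram u v :
  hnorm (u + v) ^+ 2 + hnorm (u - v) ^+ 2 = (hnorm u ^+ 2 + hnorm v ^+ 2) *+ 2.
Proof.
rewrite !hnorm_sqr -!raddfD -raddfMn /=; congr complex.Re.
by rewrite ipDl ipBl !ipDr !ipNr; ring.
Qed.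

(** Expanding the nonnegative value of the form at [v - t w], with [t] chosen
    to minimise it, gives the inequality for every positive operator. *)
Lemma positive_CS T v w : linear T -> adjoint_pair T T ->
  (forall v, 0 <= ip (T v) v) ->
  `|ip (T v) w| ^+ 2 <= ip (T v) v * ip (T w) w.
Proof.
move=> lT sT pT.
have TB x y t : T (x - t *: y) = T x - t *: T y.
  by rewrite linB// linZ.
have bC : ip (T w) v = cj (ip (T v) w) by rewrite sT ipC.
have ex t : ip (T (v - t *: w)) (v - t *: w) =
    ip (T v) v - cj t * ip (T v) w - t * cj (ip (T v) w) + t * cj t * ip (T w) w.
  by rewrite TB !ipBl !ipBr !ipZl !ipZr bC; ring.
have wr : cj (ip (T w) w) = ip (T w) w by apply/CrealP/ger0_real.
set a := ip (T v) v in ex *; set b := ip (T v) w in ex *.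
set d := ip (T w) w in ex wr *.
have a0 : 0 <= a by exact: pT.
have d0 : 0 <= d by exact: pT.
have [dz|dn] := eqVneq d 0.
  have [->|bn] := eqVneq b 0; first by rewrite normr0 expr0n mulr_ge0.
  have nb : 0 < `|b| ^+ 2 by rewrite exprn_gt0// normr_gt0.
  (* The form is affine in [s] along [v - s b w] when [d = 0]; this [s] makes it
     negative. *)
  pose s := (a + 1) / `|b| ^+ 2.
  have sr : cj s = s by apply/CrealP/ger0_real; rewrite divr_ge0 ?addr_ge0// ltW.
  have := pT (v - (s * b) *: w).
  rewrite ex dz mulr0 addr0 cjM sr.
  have -> : a - s * cj b * b - s * b * cj b = a - 2 * (s * (b * cj b)) by ring.
  rewrite -normCK divfK ?gt_eqF//.
  have -> : a - 2 * (a + 1) = - (a + 2) by ring.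
  have a2 : 0 < a + 2 by rewrite ltr_wpDl.
  by rewrite oppr_ge0 => /(lt_le_trans a2); rewrite ltxx.
have := pT (v - (b / d) *: w); rewrite ex.
rewrite cj_div wr.
have -> : a - cj b / d * b - b / d * cj b + b / d * (cj b / d) * d =
    (a * d - b * cj b) / d.
  by field.
rewrite -normCK pmulr_lge0 ?subr_ge0// invr_gt0 lt_def dn d0//.
Qed.

Lemma positive_form0 T v : linear T -> adjoint_pair T T ->
  (forall v, 0 <= ip (T v) v) -> ip (T v) v = 0 -> T v = 0.
Proof.
move=> lT sT pT h; apply: ip_inj => w; rewrite ip0l.
have := positive_CS v w lT sT pT; rewrite h mul0r => h2.
by apply/eqP; rewrite -normr_eq0 -sqrf_eq0 eq_le h2 exprn_ge0.
Qed.

End InnerProduct.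

(* Linear identities between vectors are ring identities between their inner
   products with a test vector. *)
Ltac vec := apply: ip_inj => ?; rewrite ?(ipDl, ipNl, ipZl, ip0l, scale0r); ring.

(** * Norm estimates in place of neighbourhoods *)

Section Topology.
Context {R : realType} {H : hilbertType R}.
Implicit Types (u v w : H) (c : R[i]) (T S : H -> H).

Lemma pos_realC (e : R[i]) : 0 < e -> exists2 r : R, 0 < r & e = r%:C.
Proof.
move=> e0; exists (complex.Re e); last by rewrite RRe_real// ger0_real// ltW.
by rewrite -ltcR RRe_real// ger0_real// ltW.
Qed.

Lemma nbhs_hnormP v (B : set H) :
  nbhs v B <-> exists2 e : R, 0 < e & forall u, hnorm (u - v) < e -> B u.
Proof.
split=> [/nbhs_normP[_ /pos_realC[r r0 ->] sB]|[r r0 sB]].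
  by exists r => // u uv; apply: sB; rewrite /ball_/= hnormE ltcR hnormBC.
apply/nbhs_normP; exists (r%:C); first by rewrite /= ltcR.
by move=> u; rewrite /ball_/= hnormE ltcR hnormBC => /sB.
Qed.

Lemma closure_hnormP (D : set H) v :
  closure D v <-> forall e : R, 0 < e -> exists2 u, D u & hnorm (u - v) < e.
Proof.
split=> [cD e e0|h B /nbhs_hnormP[e e0 sB]].
  have [|u [Du ue]] := cD [set u | hnorm (u - v) < e]; last by exists u.
  by apply/nbhs_hnormP; exists e.
by have [u Du ue] := h e e0; exists u; split=> //; exact: sB.
Qed.

Lemma closure_graphP (x : oper H) (v : H * H) :
  closure x v <-> forall e : R, 0 < e -> exists2 u, x u &
    hnorm (u.1 - v.1) < e /\ hnorm (u.2 - v.2) < e.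
Proof.
split=> [cD e e0|h B].
  have [|u [Du [ue1 ue2]]] :=
    cD [set u | hnorm (u.1 - v.1) < e /\ hnorm (u.2 - v.2) < e].
    exists ([set u | hnorm (u - v.1) < e], [set u | hnorm (u - v.2) < e]).
      by split; apply/nbhs_hnormP; exists e.
    by move=> u [].
  by exists u.
move=> [[B1 B2] [/= /nbhs_hnormP[e1 e10 s1] /nbhs_hnormP[e2 e20 s2]] sB].
have [|u xu] := h (Num.min e1 e2); first by rewrite lt_min e10.
rewrite !lt_min => -[/andP[h1 _] /andP[_ h2]].
by exists u; split=> //; apply: sB; split; [exact: s1|exact: s2].
Qed.

Lemma closed_hnorm (D : set H) v : closed D ->
  (forall e : R, 0 < e -> exists2 u, D u & hnorm (u - v) < e) -> D v.
Proof. by move=> cD h; apply: cD; apply/closure_hnormP. Qed.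

Lemma hnorm_complete (u : nat -> H) :
  (forall e : R, 0 < e -> exists N, forall m n, (N <= m)%N -> (N <= n)%N ->
    hnorm (u m - u n) < e) ->
  exists l, forall e : R, 0 < e -> exists N, forall n, (N <= n)%N ->
    hnorm (u n - l) < e.
Proof.
move=> cu.
have /cauchy_cvgP /cvg_ex[l ul] : cauchy (u @ \oo).
  apply/cauchy_ballP => _ /pos_realC[e e0 ->].
  have [N hN] := cu e e0.
  exists ([set u n | n in [set n | (N <= n)%N]], [set u n | n in [set n | (N <= n)%N]]).
    by split; exists N => // n /= Nn; exists n.
  move=> [_ _] /= [[m Nm <-] [n Nn <-]].
  by rewrite -ball_normE /ball_/= hnormE ltcR hN.
exists l => e e0; have /cvgrPdist_lt/(_ e%:C) := ul.
rewrite ltcR => /(_ e0)[N _ hN]; exists N => n /hN /=.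
by rewrite hnormE ltcR hnormBC.
Qed.

Lemma bounded_opP T : bounded_op T <->
  linear T /\ exists2 k : R, 0 < k & forall v, hnorm (T v) <= k * hnorm v.
Proof.
split=> [[lT cT]|[lT [k k0 hk]]]; split=> //.
  have /nbhs_hnormP[d d0 hd] : nbhs (0 : H) (T @^-1` [set u | hnorm u < 1]).
    apply: cT; rewrite (lin0 lT); apply/nbhs_hnormP; exists 1 => // u.
    by rewrite subr0.
  exists (2 / d); first by rewrite divr_gt0.
  move=> v; have [->|vn] := eqVneq v 0; first by rewrite (lin0 lT) hnorm0 mulr0.
  have nv : 0 < hnorm v.
    rewrite lt_def hnorm_ge0 andbT; apply: contra vn => /eqP h.
    by apply/eqP/hnorm_eq0.
  have : hnorm (T ((d / 2 / hnorm v)%:C *: v)) < 1.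
    apply: hd; rewrite subr0 hnormZr ger0_norm ?divfK ?gt_eqF//; first lra.
    by rewrite divr_ge0 ?divr_ge0// ltW.
  have a0 : 0 < d / 2 / hnorm v by rewrite !divr_gt0.
  rewrite (linZ lT) hnormZr (gtr0_norm a0) mulrC -ltr_pdivlMr// => /ltW.
  by rewrite mul1r !invf_div mulrC.
move=> v; apply/cvgrPdist_lt => _ /pos_realC[e e0 ->].
near=> u; rewrite -(linB lT) hnormE ltcR; apply: le_lt_trans (hk _) _.
rewrite -ltr_pdivlMl//; near: u; apply/nbhs_hnormP.
by exists (k^-1 * e); [rewrite mulr_gt0// invr_gt0|move=> u; rewrite hnormBC].
Unshelve. all: by end_near. Qed.

Lemma bounded_lin T : bounded_op T -> linear T. Proof. by case. Qed.

End Topology.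

(** * Orthogonal projections *)

Section Projection.
Context {R : realType} {H : hilbertType R}.
Implicit Types (u v w : H) (c : R[i]) (T S : H -> H) (D : set H).

Local Notation ip := (inner H).
Local Notation cj := (@Num.conj R[i]).

Lemma small_inv (e : R) : 0 < e ->
  exists N, forall n, (N <= n)%N -> n.+1%:R^-1 < e.
Proof.
move=> e0; have [N _ hN] := near_infty_natSinv_lt (PosNum e0).
by exists N => n Nn; exact: hN.
Qed.

Lemma ip_CS u v : `|ip u v| <= (hnorm u * hnorm v)%:C.
Proof.
have := @positive_CS _ _ id u v (fun _ _ _ => erefl) (fun _ _ => erefl) ip_ge0.
rewrite !ip_hnorm -realCM -exprMn.
rewrite (_ : (_ ^+ 2)%:C = (hnorm u * hnorm v)%:C ^+ 2); last exact: rmorphXn.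
by rewrite ler_sqr// nnegrE ler0c mulr_ge0 ?hnorm_ge0.
Qed.

Definition lin_subspace D := D 0 /\ forall c u v, D u -> D v -> D (c *: u + v).

Lemma subspaceD D u v : lin_subspace D -> D u -> D v -> D (u + v).
Proof. by move=> [_ h] Du Dv; rewrite -[u]scale1r; exact: h. Qed.

Lemma subspaceZ D c v : lin_subspace D -> D v -> D (c *: v).
Proof. by move=> [h0 h] Dv; rewrite -[c *: v]addr0; exact: h. Qed.

Lemma subspaceB D u v : lin_subspace D -> D u -> D v -> D (u - v).
Proof.
by move=> sD Du Dv; apply: subspaceD => //; rewrite -scaleN1r; exact: subspaceZ.
Qed.

(** Pythagoras for [x] split along [w]. *)
Lemma hnorm_gram x w : w != 0 ->
  (hnorm (x - (ip x w / ip w w) *: w) ^+ 2)%:C =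
  (hnorm x ^+ 2)%:C - `|ip x w| ^+ 2 / ip w w.
Proof.
move=> w0; rewrite -!ip_hnorm ipBl !ipBr !ipZl !ipZr (ipC w x) cj_div.
have dn : ip w w != 0 by apply: contra w0 => /eqP/ip_eq0 ->.
have -> : cj (ip w w) = ip w w by rewrite -ipC.
by rewrite normCK; field.
Qed.

(** If [v - p] had a component along some [w] in [D], removing it would bring
    [p] closer to [v]. *)
Lemma closest_orthogonal D v p : lin_subspace D -> D p ->
  (forall w, D w -> hnorm (v - p) ^+ 2 <= hnorm (v - w) ^+ 2) ->
  forall w, D w -> ip (v - p) w = 0.
Proof.
move=> sD Dp pmin w Dw; have [->|w0] := eqVneq w 0; first by rewrite ip0r.
set t := ip (v - p) w / ip w w.
have := pmin _ (subspaceD sD Dp (subspaceZ t sD Dw)).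
rewrite opprD addrA -lecR (hnorm_gram _ w0).
have dn : 0 < ip w w.
  by rewrite lt_def ip_ge0 andbT; apply: contra w0 => /eqP/ip_eq0 ->.
rewrite lerBrDr gerDl => h; apply/eqP; rewrite -normr_eq0 -sqrf_eq0.
have : 0 <= `|ip (v - p) w| ^+ 2 by rewrite exprn_ge0.
move=> h2; rewrite eq_le h2 andbT.
by move: h; rewrite pmulr_lle0// invr_gt0.
Qed.

(** A minimising sequence is Cauchy by the parallelogram law. *)
Lemma closest_point D v : closed D -> lin_subspace D ->
  exists2 p, D p & forall w, D w -> ip (v - p) w = 0.
Proof.
move=> cD sD.
set E := [set hnorm (v - w) ^+ 2 | w in D].
have lbE : has_lbound E by exists 0 => _ [w _ <-]; exact: sqr_ge0.
have E0 : E !=set0 by exists (hnorm (v - 0) ^+ 2); exists 0 => //; case: sD.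
set d := inf E.
have dmin w : D w -> d <= hnorm (v - w) ^+ 2.
  by move=> Dw; apply: ge_inf => //; exists w.
have /choice[u hu] n : exists u, D u /\ hnorm (v - u) ^+ 2 < d + n.+1%:R^-1.
  have [||_ [u Du <-] ?] := @inf_adherent _ E n.+1%:R^-1; rewrite ?invr_gt0//.
  by exists u.
have cu (e : R) : 0 < e -> exists N, forall m n, (N <= m)%N -> (N <= n)%N ->
    hnorm (u m - u n) < e.
  move=> e0; have [|N hN] := @small_inv (e ^+ 2 / 4).
    by rewrite divr_gt0 ?exprn_gt0.
  exists N => m n /hN Nm /hN Nn.
  have [Dm hm] := hu m; have [Dn hn] := hu n.
  have := parallelogram (v - u n) (v - u m).
  have -> : v - u n - (v - u m) = u m - u n by rewrite opprB addrC addrA subrK.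
  have Dmid : D ((2^-1)%:C *: (u n + u m)) by apply: subspaceZ => //; exact: subspaceD.
  have -> : v - u n + (v - u m) = (2 : R)%:C *: (v - (2^-1)%:C *: (u n + u m)).
    rewrite scalerBr scalerA -realCM mulfV// scale1r.
    by rewrite (_ : 2%:C = 1 + 1) 1?scalerDl ?scale1r 1?addrACA ?opprD// realCD.
  rewrite hnormZr ger0_norm// exprMn.
  have := dmin _ Dmid.
  set a := hnorm _ ^+ 2; set b := hnorm _ ^+ 2 in hn *.
  move: hm; set c' := hnorm _ ^+ 2 => hm hd hp.
  rewrite -(@ltr_pXn2r _ 2)// ?nnegrE ?hnorm_ge0 ?(ltW e0)//.
  move: hp; set z := e ^+ 2 in Nm Nn *.
  rewrite (_ : 2 ^+ 2 = 4 :> R) => [hp|]; last by ring.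
  move: hm hn hd hp Nm Nn; rewrite mulr2n.
  move: (m.+1%:R^-1) (n.+1%:R^-1) a b c' z (hnorm (u m - u n) ^+ 2).
  move=> im im2 a b c' z y.
  lra.
have [p hp] := hnorm_complete cu.
have Dp : D p.
  apply: (closed_hnorm cD) => e e0; have [N hN] := hp e e0.
  by exists (u N); [case: (hu N)|exact: hN].
exists p => //; apply: closest_orthogonal => // w Dw.
apply: le_trans (dmin w Dw).
rewrite leNgt; apply/negP => dlt.
(* [e] is chosen with [(s - e) ^ 2 > d + e]; a [u n] within [e] of [p] and within
   [e] of the infimum violates this. *)
set s := hnorm (v - p) in dlt.
have s0 : 0 <= s by exact: hnorm_ge0.
set e := (s ^+ 2 - d) / (2 * s + 1).
have e0 : 0 < e by rewrite divr_gt0 ?subr_gt0// ltr_wpDl// mulr_ge0.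
have [N1 h1] := hp e e0; have [N2 h2] := small_inv e0.
have := h1 _ (leq_maxl N1 N2); have := h2 _ (leq_maxr N1 N2).
set n := maxn N1 N2 => hn2 hn1.
have [_ hun] := hu n.
have : s <= hnorm (v - u n) + hnorm (u n - p).
  by rewrite /s -{1}(subrK (u n) v) -addrA hnorm_triangle.
have eE : e * (2 * s + 1) = s ^+ 2 - d by rewrite divfK// gt_eqF// ltr_wpDl// mulr_ge0.
have := hnorm_ge0 (v - u n); move: hun hn1 hn2.
have d0 : 0 <= d by apply: lb_le_inf => // _ [w' _ <-]; exact: sqr_ge0.
move: (hnorm (v - u n)) (hnorm (u n - p)) (n.+1%:R^-1) => a b r hun hn1 hn2 a0 hs.
have es : e <= s by nra.
have : (s - e) ^+ 2 <= a ^+ 2 by rewrite ler_pXn2r// ?nnegrE ?subr_ge0//; lra.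
have : 0 <= e ^+ 2 by exact: sqr_ge0.
clear -hun hn2 eE; nra.
Qed.

Definition is_proj_on D P := [/\ linear P, (forall v, D (P v)),
  (forall v, D v -> P v = v), adjoint_pair P P &
  forall v w, D w -> ip (v - P v) w = 0].

Lemma orthogonal_unique D v p q : lin_subspace D -> D p -> D q ->
  (forall w, D w -> ip (v - p) w = 0) -> (forall w, D w -> ip (v - q) w = 0) ->
  q = p.
Proof.
move=> sD Dp Dq op oq; apply/subr0_eq/ip_eq0.
have D1 : D (q - p) by exact: subspaceB.
rewrite -{1}(subrK v q) -addrA ipDl op// addr0.
by rewrite -opprB ipNl oq// oppr0.
Qed.

Lemma proj_exists D : closed D -> lin_subspace D -> exists P, is_proj_on D P.
Proof.
move=> cD sD.
have /choice[P hP] v : exists p, D p /\ forall w, D w -> ip (v - p) w = 0.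
  by have [p ? ?] := closest_point v cD sD; exists p.
have uq v q : D q -> (forall w, D w -> ip (v - q) w = 0) -> q = P v.
  by have [DP oP] := hP v => Dq oq; exact: orthogonal_unique oP oq.
exists P; split.
- move=> a u v; apply/esym/uq; have [Du ou] := hP u; have [Dv ov] := hP v.
    by case: sD => _; exact.
  move=> w Dw; rewrite opprD addrACA -scalerBr ipDl ipZl ou// ov//.
  by rewrite mulr0 addr0.
- by move=> v; case: (hP v).
- by move=> v Dv; apply/esym/uq => // w _; rewrite subrr ip0l.
- move=> u v; have [Du ou] := hP u; have [Dv ov] := hP v.
  have -> : ip u (P v) = ip (P u) (P v) by apply/subr0_eq; rewrite -ipBl ou.
  by apply/subr0_eq; rewrite -ipBr ipC ov// rmorph0.
- by move=> v w Dw; case: (hP v) => _; exact.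
Qed.

Lemma proj_le D P v : is_proj_on D P -> hnorm (P v) <= hnorm v.
Proof.
move=> [_ DP _ _ oP]; rewrite -(@ler_pXn2r _ 2)// ?nnegrE ?hnorm_ge0//.
have := @hnorm_pythag _ _ (v - P v) (P v) (oP _ _ (DP v)).
by rewrite subrK => ->; rewrite lerDr sqr_ge0.
Qed.

Lemma proj_bounded D P : is_proj_on D P -> bounded_op P.
Proof.
move=> hP; apply/bounded_opP; split; first by case: hP.
by exists 1 => // v; rewrite mul1r; exact: proj_le hP.
Qed.

(** [W (P v)] has the property that characterises [P (W v)]. *)
Lemma proj_commute D P W W' : lin_subspace D -> is_proj_on D P ->
  linear W -> adjoint_pair W W' ->
  (forall v, D v -> D (W v)) -> (forall v, D v -> D (W' v)) ->
  forall v, P (W v) = W (P v).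
Proof.
move=> sD [_ DP _ _ oP] lW aW hW hW' v; apply/esym.
apply: (orthogonal_unique sD (DP _) (hW _ (DP v)) (oP _)) => w Dw.
by rewrite -linB// aW oP//; exact: hW'.
Qed.

(** A vector outside the closure would leave a nonzero component orthogonal to
    the closure. *)
Lemma dense_subspace D : lin_subspace D ->
  (forall w, (forall v, D v -> ip v w = 0) -> w = 0) ->
  forall v (e : R), 0 < e -> exists2 u, D u & hnorm (u - v) < e.
Proof.
move=> sD h v; apply/closure_hnormP.
have scD : lin_subspace (closure D).
  split; first by apply: subset_closure; case: sD.
  move=> c u w /closure_hnormP hu /closure_hnormP hw; apply/closure_hnormP => e e0.
  set k := complex.Re `|c|.
  have k0 : 0 <= k by rewrite -ler0c /k RRe_real ?ger0_real.
  have [|u1 Du1 hu1] := hu (e / 2 / (k + 1)); first by rewrite !divr_gt0// ltr_wpDl.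
  have [|w1 Dw1 hw1] := hw (e / 2); first by rewrite divr_gt0.
  exists (c *: u1 + w1); first by case: sD => _; exact.
  rewrite opprD addrACA -scalerBr; apply: le_lt_trans (hnorm_triangle _ _) _.
  rewrite hnormZ -/k.
  have : k * hnorm (u1 - u) <= e / 2.
    move: hu1; rewrite ltr_pdivlMr ?ltr_wpDl// => hu1.
    by have := hnorm_ge0 (u1 - u); nra.
  by lra.
have [p Dp op] := closest_point v (@closed_closure _ D) scD.
suff -> : v = p by [].
apply/subr0_eq/h => u Du; rewrite ipC op ?rmorph0//.
exact: subset_closure.
Qed.

End Projection.

(** * Square roots of positive operators *)

Section SquareRoot.
Context {R : realType} {H : hilbertType R}.
Implicit Types (u v w : H) (c : R[i]) (T S : H -> H) (D : set H).

Local Notation ip := (inner H).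

Lemma symmetric_real T v : adjoint_pair T T -> ip (T v) v \is Num.real.
Proof. by move=> sT; apply/CrealP; rewrite -ipC sT. Qed.

(** Increases to 1, and dominates the norms of the operator iteration
    [sqrt_iter] below, which is the same recursion. *)
Fixpoint sqrt_bound (n : nat) : R :=
  if n is m.+1 then (1 + sqrt_bound m ^+ 2) / 2 else 0.

Lemma sqrt_boundS n : sqrt_bound n.+1 = (1 + sqrt_bound n ^+ 2) / 2.
Proof. by []. Qed.

Lemma sqrt_bound01 n : 0 <= sqrt_bound n <= 1.
Proof. by elim: n => [|n /andP[h0 h1]] /=; first lra; apply/andP; split; nra. Qed.

Lemma sqrt_bound_le n : sqrt_bound n <= sqrt_bound n.+1.
Proof. by have /andP[h0 h1] := sqrt_bound01 n => /=; nra. Qed.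

(** The deficit [d = 1 - sqrt_bound n] obeys [d' = d - d ^ 2 / 2]. *)
Lemma sqrt_bound_rate n : 1 - sqrt_bound n <= 2 / n.+2%:R.
Proof.
elim: n => [|n ih]; first by rewrite /=; lra.
have /andP[h0 h1] := sqrt_bound01 n.
rewrite /=; set y := sqrt_bound n in h0 h1 ih *.
have n0 : 0 < n.+2%:R :> R by [].
have -> : n.+3%:R = n.+2%:R + 1 :> R by rewrite -natr1.
have n2 : 2 <= n.+2%:R :> R by rewrite ler_nat.
rewrite ler_pdivlMr; last lra.
move: ih; rewrite ler_pdivlMr// => ih.
move: n.+2%:R n0 n2 ih => m m0 m2 ih.
set d := 1 - y in ih *.
have -> : 1 - (1 + y ^+ 2) / 2 = d - d ^+ 2 / 2 by rewrite /d; field.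
have d0 : 0 <= d by rewrite /d; lra.
have d1 : d <= 1 by rewrite /d; lra.
nra.
Qed.

Lemma sqrt_bound_lim0 (x K : R) :
  0 <= K -> (forall n, x <= (1 - sqrt_bound n) * K) -> x <= 0.
Proof.
move=> K0 h; rewrite leNgt; apply/negP => x0.
have [|N hN] := @small_inv R (x / (2 * (K + 1))).
  by rewrite divr_gt0// mulr_gt0// ltr_wpDl.
have := h N; have := sqrt_bound_rate N; have := hN N.+1 (leqnSn N).
rewrite ltr_pdivlMr ?mulr_gt0 ?ltr_wpDl//.
have : 0 <= N.+2%:R^-1 :> R by rewrite invr_ge0.
move: (N.+2%:R^-1) (1 - sqrt_bound N) => r d r0 h1 h2 h3.
nra.
Qed.

Section Iteration.
Variables (C : H -> H).
Hypotheses (lC : linear C) (sC : adjoint_pair C C)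
  (C1 : forall v, hnorm (C v) <= hnorm v).

(** Fixed-point iteration for [Y = (C + Y ^ 2) / 2], that is
    [(1 - Y) ^ 2 = 1 - C]; [sqrt_bound] is the same iteration with [C = 1]. *)
Fixpoint sqrt_iter (n : nat) (v : H) : H :=
  if n is m.+1 then (2^-1)%:C *: (C v + sqrt_iter m (sqrt_iter m v)) else 0.

Lemma sqrt_iterS n v :
  sqrt_iter n.+1 v = (2^-1)%:C *: (C v + sqrt_iter n (sqrt_iter n v)).
Proof. by []. Qed.

Lemma sqrt_iter_linear n : linear (sqrt_iter n).
Proof.
elim: n => [|n ih] c u v /=; first by rewrite scaler0 addr0.
rewrite lC !ih scalerA mulrC -scalerA -scalerDr; congr (_ *: _).
by rewrite scalerDr addrACA.
Qed.

Lemma sqrt_iter_commute W n : linear W -> (forall v, W (C v) = C (W v)) ->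
  forall v, W (sqrt_iter n v) = sqrt_iter n (W v).
Proof.
move=> lW cW; elim: n => [|n ih] v /=; first exact: lin0.
by rewrite (linZ lW) (linD lW) cW !ih.
Qed.

Lemma sqrt_iter_commuteC m n v :
  sqrt_iter m (sqrt_iter n v) = sqrt_iter n (sqrt_iter m v).
Proof.
apply: sqrt_iter_commute => [|w]; first exact: sqrt_iter_linear.
by apply/esym/sqrt_iter_commute.
Qed.

Lemma sqrt_iter_sym n : adjoint_pair (sqrt_iter n) (sqrt_iter n).
Proof.
elim: n => [|n ih] u v /=; first by rewrite ip0l ip0r.
by rewrite ipZl ipZr realC_conj ipDl ipDr sC !ih.
Qed.

Lemma sqrt_iter_le n v : hnorm (sqrt_iter n v) <= sqrt_bound n * hnorm v.
Proof.
elim: n v => [|n ih] v /=; first by rewrite hnorm0 mul0r.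
rewrite hnormZr ger0_norm ?invr_ge0//.
have := hnorm_triangle (C v) (sqrt_iter n (sqrt_iter n v)).
have /andP[h0 h1] := sqrt_bound01 n.
have := C1 v; have := ih v; have := ih (sqrt_iter n v); have := hnorm_ge0 v.
move: (hnorm _) (hnorm _) (hnorm _) (hnorm _) (hnorm _) (sqrt_bound n) h0 h1.
move=> a b c d e y *; nra.
Qed.

(** The iterates commute, so that a difference of squares factorises. *)
Lemma sqrt_iter_step n v : hnorm (sqrt_iter n.+1 v - sqrt_iter n v) <=
  (sqrt_bound n.+1 - sqrt_bound n) * hnorm v.
Proof.
elim: n v => [|n ih] v.
  by have := sqrt_iter_le 1 v; rewrite [sqrt_iter 0 v]/= [sqrt_bound 0]/= !subr0.
set d := sqrt_iter n.+1 v - sqrt_iter n v.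
have -> : sqrt_iter n.+2 v - sqrt_iter n.+1 v =
    (2^-1)%:C *: (sqrt_iter n.+1 d + sqrt_iter n d).
  rewrite (sqrt_iterS n.+1) [X in _ - X]sqrt_iterS -scalerBr; congr (_ *: _).
  rewrite /d (linB (sqrt_iter_linear _)) (linB (sqrt_iter_linear n)).
  by rewrite (sqrt_iter_commuteC n n.+1); vec.
rewrite hnormZr ger0_norm ?invr_ge0//.
have := hnorm_triangle (sqrt_iter n.+1 d) (sqrt_iter n d).
have := ih v; rewrite -/d.
have := sqrt_iter_le n.+1 d; have := sqrt_iter_le n d.
have -> : sqrt_bound n.+2 - sqrt_bound n.+1 =
  (sqrt_bound n.+1 + sqrt_bound n) * (sqrt_bound n.+1 - sqrt_bound n) / 2.
  by rewrite (sqrt_boundS n.+1) [X in _ - X]sqrt_boundS; field.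
have /andP[h0 _] := sqrt_bound01 n; have /andP[h1 _] := sqrt_bound01 n.+1.
have := sqrt_bound_le n; have := hnorm_ge0 v; have := hnorm_ge0 d.
move: (hnorm _) (hnorm _) (hnorm _) (hnorm _) (hnorm _) h0 h1.
move: (sqrt_bound n.+1) (sqrt_bound n).
move=> y' y a b c e f *; nra.
Qed.

Lemma sqrt_iter_dist n m v : (n <= m)%N ->
  hnorm (sqrt_iter m v - sqrt_iter n v) <= (sqrt_bound m - sqrt_bound n) * hnorm v.
Proof.
move=> /subnKC <-; elim: (m - n)%N => [|k ih].
  by rewrite addn0 !subrr hnorm0 mul0r.
rewrite addnS.
have := hnorm_triangle (sqrt_iter (n + k).+1 v - sqrt_iter (n + k) v)
                (sqrt_iter (n + k) v - sqrt_iter n v).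
rewrite addrA subrK; have := sqrt_iter_step (n + k) v; move: ih.
by rewrite !mulrBl; lra.
Qed.

(** Increments are dominated by those of [sqrt_bound], so the iteration
    converges in operator norm. *)
Lemma sqrt_iter_lim : exists L : H -> H, forall n v,
  hnorm (L v - sqrt_iter n v) <= (1 - sqrt_bound n) * hnorm v.
Proof.
have /choice[L hL] v : exists l, forall n, hnorm (l - sqrt_iter n v) <=
    (1 - sqrt_bound n) * hnorm v.
  have [|l hl] := @hnorm_complete _ H (sqrt_iter^~ v).
    move=> e e0.
    have [|N hN] := @small_inv R (e / (4 * (hnorm v + 1))).
      by rewrite divr_gt0// mulr_gt0// ltr_wpDl// hnorm_ge0.
    exists N => m n Nm Nn.
    have := hnorm_triangle (sqrt_iter m v - sqrt_iter N v)
               (sqrt_iter N v - sqrt_iter n v).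
    rewrite addrA subrK (hnormBC (sqrt_iter N v)).
    have near_N k : (N <= k)%N ->
        hnorm (sqrt_iter k v - sqrt_iter N v) <= 2 * N.+2%:R^-1 * hnorm v.
      move=> Nk; apply: le_trans (sqrt_iter_dist v Nk) _.
      rewrite ler_wpM2r ?hnorm_ge0//; apply: le_trans (sqrt_bound_rate N).
      by rewrite lerD2r; case/andP: (sqrt_bound01 k).
    have := near_N _ Nm; have := near_N _ Nn; have := hN N.+1 (leqnSn N).
    have : 0 <= N.+2%:R^-1 :> R by rewrite invr_ge0.
    rewrite ltr_pdivlMr ?mulr_gt0 ?ltr_wpDl ?hnorm_ge0//.
    move: (N.+2%:R^-1) => r; nra.
  exists l => n; apply/ler_addgt0Pr => e e0; have [N hN] := hl e e0.
  have := hN _ (leq_maxl N n); have := sqrt_iter_dist v (leq_maxr N n).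
  have /andP[_ h1] := sqrt_bound01 (maxn N n); have := hnorm_ge0 v.
  have := hnorm_triangle (l - sqrt_iter (maxn N n) v)
             (sqrt_iter (maxn N n) v - sqrt_iter n v).
  rewrite addrA subrK (hnormBC l (sqrt_iter (maxn N n) v)).
  by nra.
by exists L => n v; exact: hL.
Qed.

Variable L : H -> H.
Hypothesis hL : forall n v,
  hnorm (L v - sqrt_iter n v) <= (1 - sqrt_bound n) * hnorm v.

Let hnorm_lim0 (x : H) (K : R) : 0 <= K ->
  (forall n, hnorm x <= (1 - sqrt_bound n) * K) -> x = 0.
Proof.
move=> K0 h; apply: hnorm_eq0; apply/eqP; rewrite eq_le hnorm_ge0 andbT.
exact: sqrt_bound_lim0 h.
Qed.

Lemma sqrt_lim_le v : hnorm (L v) <= hnorm v.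
Proof. by have := hL 0 v; rewrite /= !subr0 mul1r. Qed.

Lemma sqrt_lim_linear : linear L.
Proof.
move=> c u v; apply/subr0_eq.
set k := complex.Re `|c|.
have k0 : 0 <= k by rewrite -ler0c /k RRe_real ?ger0_real.
apply: (@hnorm_lim0 _ (hnorm (c *: u + v) + k * hnorm u + hnorm v)).
  by rewrite !addr_ge0 ?mulr_ge0 ?hnorm_ge0.
move=> n.
have -> : L (c *: u + v) - (c *: L u + L v) =
    (L (c *: u + v) - sqrt_iter n (c *: u + v)) +
    (- (c *: (L u - sqrt_iter n u)) - (L v - sqrt_iter n v)).
  by rewrite sqrt_iter_linear; vec.
have := hL n (c *: u + v); have := hL n u; have := hL n v.
have := hnorm_triangle (L (c *: u + v) - sqrt_iter n (c *: u + v))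
  (- (c *: (L u - sqrt_iter n u)) - (L v - sqrt_iter n v)).
have := hnorm_triangle (- (c *: (L u - sqrt_iter n u))) (- (L v - sqrt_iter n v)).
rewrite !hnorm_opp hnormZ -/k.
have := hnorm_ge0 (L u - sqrt_iter n u).
nra.
Qed.

Lemma sqrt_lim_commute W : bounded_op W -> (forall v, W (C v) = C (W v)) ->
  forall v, W (L v) = L (W v).
Proof.
move=> /bounded_opP[lW [k k0 hk]] cW v; apply/subr0_eq.
apply: (@hnorm_lim0 _ (k * hnorm v + hnorm (W v))).
  by rewrite !addr_ge0 ?mulr_ge0 ?hnorm_ge0 ?(ltW k0).
move=> n.
have -> : W (L v) - L (W v) = W (L v - sqrt_iter n v) -
    (L (W v) - sqrt_iter n (W v)).
  by rewrite (linB lW) (sqrt_iter_commute n lW cW); vec.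
have := hL n (W v); have := hL n v; have := hk (L v - sqrt_iter n v).
have := hnorm_triangle (W (L v - sqrt_iter n v)) (- (L (W v) - sqrt_iter n (W v))).
rewrite hnorm_opp.
move: (hnorm _) (hnorm _) (hnorm _) (hnorm _) (hnorm _) (hnorm _) (sqrt_bound n).
move=> *; nra.
Qed.

Lemma sqrt_lim_sym : adjoint_pair L L.
Proof.
move=> u v; apply/subr0_eq/eqP; rewrite -normr_eq0.
rewrite -[`|_|]RRe_real ?ger0_real//; set x := complex.Re _.
have x0 : 0 <= x by rewrite -ler0c /x RRe_real ?ger0_real.
suff : x <= 0 by move=> x1; rewrite (_ : x = 0) //; apply/eqP; rewrite eq_le x1.
apply: (@sqrt_bound_lim0 _ (2 * hnorm u * hnorm v)).
  by rewrite !mulr_ge0 ?hnorm_ge0.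
move=> n; rewrite -lecR /x RRe_real ?ger0_real//.
have -> : ip (L u) v - ip u (L v) =
    ip (L u - sqrt_iter n u) v - ip u (L v - sqrt_iter n v).
  by rewrite ipBl ipBr sqrt_iter_sym; ring.
apply: le_trans (ler_normB _ _) _.
have := ip_CS (L u - sqrt_iter n u) v; have := ip_CS u (L v - sqrt_iter n v).
move=> h1 h2; apply: le_trans (lerD h2 h1) _; rewrite -realCD lecR.
have := hL n u; have := hL n v; have := hnorm_ge0 u; have := hnorm_ge0 v.
move: (hnorm _) (hnorm _) (hnorm _) (hnorm _) (sqrt_bound n).
move=> *; nra.
Qed.

Lemma sqrt_lim_eq v : L v + L v = C v + L (L v).
Proof.
apply/subr0_eq; apply: (@hnorm_lim0 _ (4 * hnorm v)).
  by rewrite !mulr_ge0 ?hnorm_ge0.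
move=> n; set d := L v - sqrt_iter n v.
have e1 : sqrt_iter n.+1 v + sqrt_iter n.+1 v = C v + sqrt_iter n (sqrt_iter n v).
  rewrite sqrt_iterS -scalerDl -realCD -[RHS]scale1r; congr (_%:C *: _).
  by field.
set d' := L v - sqrt_iter n.+1 v.
have -> : L v + L v - (C v + L (L v)) =
    (d' + d') + (- L d - (L (sqrt_iter n v) - sqrt_iter n (sqrt_iter n v))).
  have -> : d' + d' = L v + L v - (sqrt_iter n.+1 v + sqrt_iter n.+1 v).
    by rewrite /d'; vec.
  by rewrite e1 /d (linB sqrt_lim_linear); vec.
have := hnorm_triangle (d' + d')
  (- L d - (L (sqrt_iter n v) - sqrt_iter n (sqrt_iter n v))).
have := hnorm_triangle (- L d) (- (L (sqrt_iter n v) - sqrt_iter n (sqrt_iter n v))).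
have := hnorm_triangle d' d'.
rewrite !hnorm_opp.
have := sqrt_lim_le d; have := hL n v; rewrite -/d; have := hL n.+1 v; rewrite -/d'.
have := hL n (sqrt_iter n v); have := sqrt_iter_le n v.
have := hnorm_ge0 v; have /andP[] := sqrt_bound01 n; have := sqrt_bound_le n.
move: (sqrt_bound n.+1) (sqrt_bound n) => y' y h1 h2 h3 v0 h4 h5.
have : hnorm (L (sqrt_iter n v) - sqrt_iter n (sqrt_iter n v)) <= (1 - y) * hnorm v.
  apply: le_trans h5 _; rewrite ler_wpM2l ?subr_ge0//; apply: le_trans h4 _.
  by rewrite -[leRHS]mul1r ler_wpM2r.
have : (1 - y') * hnorm v <= (1 - y) * hnorm v by rewrite ler_wpM2r// lerD2l lerN2.
clear; lra.
Qed.

End Iteration.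

(** For [k] a bound of [B], the operator [C = 1 - B / k] is a contraction, and
    the limit [L] of the iteration satisfies [(1 - L) ^ 2 = 1 - C = B / k]. As a
    limit of polynomials in [B], it commutes with whatever commutes with [B]. *)
Lemma positive_sqrt B : bounded_op B -> adjoint_pair B B ->
  (forall v, 0 <= ip (B v) v) ->
  exists S, [/\ bounded_op S, adjoint_pair S S, (forall v, 0 <= ip (S v) v),
    (forall v, S (S v) = B v) &
    forall W, bounded_op W -> (forall v, W (B v) = B (W v)) ->
      forall v, W (S v) = S (W v)].
Proof.
move=> /bounded_opP[lB [k k0 hk]] sB pB.
pose C v := v - (k^-1)%:C *: B v.
have lC : linear C by move=> c u v; rewrite /C lB; vec.
have sC : adjoint_pair C C.
  by move=> u v; rewrite /C ipBl ipBr ipZl ipZr realC_conj sB.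
have C1 v : hnorm (C v) <= hnorm v.
  rewrite -(@ler_pXn2r _ 2)// ?nnegrE ?hnorm_ge0//.
  have hb : hnorm (B v) ^+ 2 <= k * complex.Re (ip (B v) v).
    have [->|bn] := eqVneq (B v) 0; first by rewrite hnorm0 ip0l /= expr0n mulr0.
    have b0 : 0 < hnorm (B v) ^+ 2.
      rewrite exprn_gt0// lt_def hnorm_ge0 andbT.
      by apply: contra bn => /eqP/hnorm_eq0 ->.
    have := positive_CS v (B v) lB sB pB.
    have -> : ip (B v) v = (complex.Re (ip (B v) v))%:C.
      by rewrite RRe_real// symmetric_real.
    have -> : ip (B (B v)) (B v) = (complex.Re (ip (B (B v)) (B v)))%:C.
      by rewrite RRe_real// symmetric_real.
    rewrite ip_hnorm; set x := hnorm _ ^+ 2 in b0 *.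
    rewrite ger0_norm ?ler0c ?(ltW b0)// -rmorphXn -realCM lecR /=.
    have : complex.Re (ip (B (B v)) (B v)) <= k * x.
      have := le_trans (real_ler_norm (symmetric_real (B v) sB))
                (ip_CS (B (B v)) (B v)).
      rewrite -{1}(RRe_real (symmetric_real (B v) sB)) lecR => h; apply: le_trans h _.
      by rewrite /x expr2 mulrA ler_wpM2r// hnorm_ge0.
    have : 0 <= complex.Re (ip (B v) v) by rewrite -ler0c RRe_real// symmetric_real.
    move: (complex.Re _) (complex.Re _) => b a a0 h1 h2.
    have : x ^+ 2 <= a * (k * x) by apply: le_trans h2 _; rewrite ler_wpM2l.
    by move=> h3; rewrite -(ler_pM2r b0) -expr2 (mulrC k) -mulrA.
  rewrite -lecR -!ip_hnorm /C ipBl !ipBr !ipZl !ipZr realC_conj (sB v v).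
  have -> : ip v (B v) = (complex.Re (ip (B v) v))%:C.
    by rewrite -sB RRe_real// symmetric_real.
  rewrite !ip_hnorm -!realCM -!realCB lecR.
  have b0 : 0 <= complex.Re (ip (B v) v) by rewrite -ler0c RRe_real// symmetric_real.
  have : k^-1 * (k^-1 * hnorm (B v) ^+ 2) <= k^-1 * complex.Re (ip (B v) v).
    by rewrite ler_pM2l ?invr_gt0// ler_pdivrMl.
  have : 0 <= k^-1 * complex.Re (ip (B v) v) by rewrite mulr_ge0// invr_ge0 ltW.
  lra.
have [L hL] := sqrt_iter_lim lC C1.
have lL := sqrt_lim_linear lC hL.
have sL := sqrt_lim_sym sC hL.
pose s := Num.sqrt k.
have ss : s * s = k by rewrite -expr2 sqr_sqrtr// ltW.
have s0 : 0 <= s by exact: sqrtr_ge0.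
exists (fun v => s%:C *: (v - L v)); split.
- apply/bounded_opP; split; first by move=> c u v; rewrite lL; vec.
  exists (s * 2 + 1); first by rewrite ltr_wpDl// mulr_ge0.
  move=> v; rewrite hnormZr ger0_norm//.
  have := hnorm_triangle v (- L v); rewrite hnorm_opp.
  have := sqrt_lim_le hL v; have := hnorm_ge0 v.
  by nra.
- by move=> u v; rewrite ipZl ipZr realC_conj ipBl ipBr sL.
- move=> v; rewrite ipZl mulr_ge0 ?ler0c// ipBl subr_ge0 ip_hnorm.
  apply: le_trans (real_ler_norm (symmetric_real v sL)) _.
  apply: le_trans (ip_CS _ _) _; rewrite lecR expr2 ler_wpM2r ?hnorm_ge0//.
  exact: sqrt_lim_le hL v.
- move=> v; rewrite (linZ lL) (linB lL) -scalerBr scalerA -realCM ss.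
  have := sqrt_lim_eq lC C1 hL v.
  have -> : v - L v - (L v - L (L v)) = v - (L v + L v - L (L v)) by vec.
  move=> ->; rewrite addrK /C subKr scalerA -realCM mulfV ?gt_eqF//.
  by rewrite scale1r.
- move=> W bW cW v; have lW := bounded_lin bW.
  rewrite (linZ lW) (linB lW) (sqrt_lim_commute hL bW)// => w.
  by rewrite /C (linB lW) (linZ lW) cW.
Qed.

(** With [D = A - S], [D A D + D S D = (A ^ 2 - S ^ 2) D = 0] is a sum of
    positive operators, so [A D = S D = 0] and [D ^ 2 = 0]. *)
Lemma positive_sqrt_unique A S : linear A -> linear S ->
  adjoint_pair A A -> adjoint_pair S S ->
  (forall v, 0 <= ip (A v) v) -> (forall v, 0 <= ip (S v) v) ->
  (forall v, A (A v) = S (S v)) -> (forall v, A (S v) = S (A v)) ->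
  forall v, A v = S v.
Proof.
move=> lA lS sA sS pA pS e c v; set d := A v - S v.
have ez : ip (A d) d + ip (S d) d = 0.
  rewrite -ipDl; have -> : A d + S d = 0; last exact: ip0l.
  by rewrite /d (linB lA) (linB lS) e c; vec.
have := pA d; have := pS d => p1 p2.
have a0 : ip (A d) d = 0.
  apply/eqP; rewrite eq_le p2 andbT -ez lerDl//.
have s0 : ip (S d) d = 0 by move: ez; rewrite a0 add0r.
have Ad := positive_form0 lA sA pA a0; have Sd := positive_form0 lS sS pS s0.
apply/subr0_eq/ip_eq0; rewrite -/d {1}/d ipBl sA sS Ad Sd.
by rewrite subrr.
Qed.

End SquareRoot.

(** * Adjoints, von Neumann algebras and their centres *)

Section Bounded.
Context {R : realType} {H : hilbertType R}.
Implicit Types (u v w : H) (c : R[i]) (T S W : H -> H) (D : set H).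

Local Notation ip := (inner H).
Local Notation cj := (@Num.conj R[i]).

Lemma bounded_id : bounded_op (@id H).
Proof. by apply/bounded_opP; split=> //; exists 1 => // v; rewrite mul1r. Qed.

Lemma bounded_comp S T : bounded_op S -> bounded_op T ->
  bounded_op (fun v => S (T v)).
Proof.
move=> /bounded_opP[lS [k k0 hk]] /bounded_opP[lT [l l0 hl]].
apply/bounded_opP; split; first by move=> c u v; rewrite lT lS.
exists (k * l); first by rewrite mulr_gt0.
move=> v; apply: le_trans (hk _) _; rewrite -mulrA ler_wpM2l// ltW//.
Qed.

Lemma bounded_comb c S T : bounded_op S -> bounded_op T ->
  bounded_op (fun v => c *: S v + T v).
Proof.
move=> /bounded_opP[lS [k k0 hk]] /bounded_opP[lT [l l0 hl]].
have a0 : 0 <= complex.Re `|c| by rewrite -ler0c RRe_real ?ger0_real.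
apply/bounded_opP; split; first by move=> a u v; rewrite lS lT; vec.
exists (complex.Re `|c| * k + l); first by rewrite ltr_wpDl// mulr_ge0// ltW.
move=> v; apply: le_trans (hnorm_triangle _ _) _; rewrite hnormZ mulrDl -mulrA.
by apply: lerD => //; apply: ler_wpM2l.
Qed.

(** The orthogonal complement of the kernel of [f] is spanned by one vector
    [z]. *)
Lemma riesz (f : H -> R[i]) (k : R) : (forall c u v, f (c *: u + v) = c * f u + f v) ->
  (forall v, `|f v| <= (k * hnorm v)%:C) -> exists w, forall v, f v = ip v w.
Proof.
move=> lf bf.
have f0 : f 0 = 0 by have := bf 0; rewrite hnorm0 mulr0 normr_le0 => /eqP.
have fZ c u : f (c *: u) = c * f u by rewrite -[c *: u]addr0 lf f0 addr0.
have fB u v : f (u - v) = f u - f v.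
  by rewrite -scaleN1r addrC lf mulN1r addrC.
pose D := [set v | f v = 0].
have sD : lin_subspace D.
  by split=> // c u v; rewrite /D /= lf => -> ->; rewrite mulr0 addr0.
have cD : closed D.
  move=> v /closure_hnormP hv; apply/eqP; rewrite -normr_eq0 eq_le normr_ge0 andbT.
  rewrite -[`|_|]RRe_real ?ger0_real// lecR; apply/ler_addgt0Pr => e e0.
  have [|u Du ue] := hv (e / (`|k| + 1)); first by rewrite divr_gt0// ltr_wpDl.
  rewrite add0r -lecR RRe_real ?ger0_real//.
  have -> : f v = f (v - u) by rewrite fB Du subr0.
  apply: le_trans (bf _) _; rewrite lecR hnormBC.
  move: ue; rewrite ltr_pdivlMr ?ltr_wpDl// => ue.
  have := ler_norm k; have := normr_ge0 k; have := hnorm_ge0 (u - v).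
  by move: (hnorm _) (`|k|) ue => a b *; nra.
have [hf|/existsNP[v0 hv0]] := pselect (forall v, f v = 0).
  by exists 0 => v; rewrite hf ip0r.
have [p Dp op] := closest_point v0 cD sD.
set z := v0 - p in op.
have fz : f z != 0 by rewrite /z fB Dp subr0; apply/eqP.
have zz : ip z z != 0.
  by apply: contra fz => /eqP/ip_eq0 ->; rewrite f0.
exists (cj (f z / ip z z) *: z) => v.
rewrite ipZr conjCK.
have : ip z (f z *: v - f v *: z) = 0.
  by apply: op; rewrite /D /= fB !fZ mulrC subrr.
rewrite ipC => /eqP; rewrite conjC_eq0 ipBl !ipZl subr_eq0 => /eqP h.
by rewrite mulrAC h mulfK.
Qed.

Lemma adjoint_bounded T S : bounded_op T -> adjoint_pair T S -> bounded_op S.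
Proof.
move=> /bounded_opP[lT [k k0 hk]] aTS.
apply/bounded_opP; split.
  move=> c u v; apply: ip_injr => w.
  by rewrite -aTS !ipDr !ipZr -!aTS.
exists k => // v; have [->|Sv0] := eqVneq (hnorm (S v)) 0.
  by rewrite mulr_ge0 ?hnorm_ge0 // ltW.
have Sv : 0 < hnorm (S v) by rewrite lt_def Sv0 hnorm_ge0.
rewrite -(ler_pM2r Sv) -expr2 -lecR -ip_hnorm -aTS.
rewrite -[ip _ _]RRe_real; last by rewrite aTS ger0_real// ip_ge0.
rewrite lecR -lecR RRe_real; last by rewrite aTS ger0_real// ip_ge0.
apply: le_trans (real_ler_norm _) _; first by rewrite aTS ger0_real// ip_ge0.
apply: le_trans (ip_CS _ _) _; rewrite lecR mulrAC ler_wpM2r ?hnorm_ge0//.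
Qed.

Lemma adjoint_exists T : bounded_op T -> exists2 S, bounded_op S & adjoint_pair T S.
Proof.
move=> bT; have /bounded_opP[lT [k k0 hk]] := bT.
have /choice[S hS] v : exists w, forall u, ip (T u) v = ip u w.
  apply: (@riesz _ (k * hnorm v)).
    by move=> c u w; rewrite lT ipDl ipZl.
  move=> u; apply: le_trans (ip_CS _ _) _; rewrite lecR mulrAC.
  by rewrite ler_wpM2r ?hnorm_ge0.
have aTS : adjoint_pair T S by move=> u v; exact: hS.
by exists S => //; exact: adjoint_bounded aTS.
Qed.

End Bounded.

Section OperatorAlgebras.
Context {R : realType} {H : hilbertType R}.
Implicit Types (u v w : H) (c : R[i]) (T S W p q z e : H -> H) (M N : set (H -> H)).

Local Notation ip := (inner H).
Local Notation cj := (@Num.conj R[i]).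

(** The common shape of [M], of its commutant and of its centre. *)
Definition op_algebra N := [/\ N `<=` bounded_op, N id,
  (forall S T, N S -> N T -> N (fun v => S (T v))) &
  (forall c S T, N S -> N T -> N (fun v => c *: S v + T v))].

Section Closure.
Variable N : set (H -> H).
Hypothesis aN : op_algebra N.

Lemma oa_bounded T : N T -> bounded_op T. Proof. by case: aN => h _ _ _; exact: h. Qed.
Lemma oa_linear T : N T -> linear T. Proof. by move/oa_bounded/bounded_lin. Qed.
Lemma oa_id : N id. Proof. by case: aN. Qed.
Lemma oa_comp S T : N S -> N T -> N (fun v => S (T v)).
Proof. by case: aN => _ _ h _; exact: h. Qed.
Lemma oa_comb c S T : N S -> N T -> N (fun v => c *: S v + T v).
Proof. by case: aN => _ _ _; exact. Qed.

Lemma oa_add S T : N S -> N T -> N (fun v => S v + T v).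
Proof.
move=> NS NT; rewrite (_ : (fun _ => _) = (fun v => 1 *: S v + T v)).
  exact: oa_comb.
by apply/funext => v; rewrite scale1r.
Qed.

Lemma oa_sub S T : N S -> N T -> N (fun v => S v - T v).
Proof.
move=> NS NT; rewrite (_ : (fun _ => _) = (fun v => (-1) *: T v + S v)).
  exact: oa_comb.
by apply/funext => v; rewrite scaleN1r addrC.
Qed.

Lemma oa_0 : N (fun _ => 0).
Proof.
rewrite (_ : (fun _ => _) = (fun v => v - v)); last by apply/funext => v; rewrite subrr.
by apply: oa_sub; exact: oa_id.
Qed.

Lemma oa_scale c T : N T -> N (fun v => c *: T v).
Proof.
move=> NT; rewrite (_ : (fun _ => _) = (fun v => c *: T v + 0)).
  by apply: oa_comb => //; exact: oa_0.
by apply/funext => v; rewrite addr0.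
Qed.

Lemma oa_sum I (r : seq I) (P : pred I) (F : I -> H -> H) :
  (forall i, P i -> N (F i)) -> N (fun v => \sum_(i <- r | P i) F i v).
Proof.
move=> h; elim: r => [|i r ih].
  by under eq_fun do rewrite big_nil; exact: oa_0.
case Pi: (P i); last by under eq_fun do rewrite big_cons Pi.
by under eq_fun do rewrite big_cons Pi; apply: oa_add => //; exact: h.
Qed.

End Closure.

Lemma commutantP N T : commutant N T <->
  bounded_op T /\ forall S, N S -> forall v, T (S v) = S (T v).
Proof.
split=> -[bT cT]; split=> // S NS; first by move=> v; have /(congr1 (@^~ v)) := cT S NS.
by apply/funext => v; exact: cT.
Qed.

Lemma commutant_algebra N : N `<=` bounded_op -> op_algebra (commutant N).
Proof.
move=> bN; split.
- by move=> T [].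
- by apply/commutantP; split=> //; exact: bounded_id.
- move=> S T /commutantP[bS cS] /commutantP[bT cT]; apply/commutantP; split.
    exact: bounded_comp.
  by move=> W NW v; rewrite cT// cS.
- move=> c S T /commutantP[bS cS] /commutantP[bT cT]; apply/commutantP; split.
    exact: bounded_comb.
  move=> W NW v; rewrite cT// cS//.
  have lW : linear W by apply: bounded_lin; exact: bN.
  by rewrite lW.
Qed.

Lemma commutant_bounded N : commutant N `<=` bounded_op.
Proof. by move=> T []. Qed.

(** Take adjoints in [W K = K W]. *)
Lemma adjoint_commute K W W' : adjoint_pair W W' -> adjoint_pair K K ->
  (forall v, W (K v) = K (W v)) -> forall v, W' (K v) = K (W' v).
Proof.
move=> aW aK c v; apply: ip_injr => u.
by rewrite -aW -!aK -aW c.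
Qed.

Section VonNeumann.
Variable M : set (H -> H).
Hypothesis hM : von_neumann M.

Lemma vn_algebra : op_algebra M.
Proof. by case: hM => _ _ <-; apply: commutant_algebra; exact: commutant_bounded. Qed.

Lemma vn_commutant_algebra : op_algebra (commutant M).
Proof. by apply: commutant_algebra; case: hM. Qed.

Lemma center_algebra : op_algebra (vn_center M).
Proof.
have [b1 i1 c1 l1] := vn_algebra; have [b2 i2 c2 l2] := vn_commutant_algebra.
split=> //.
- by move=> T [MT _]; exact: b1.
- by move=> S T [? ?] [? ?]; split; [exact: c1|exact: c2].
- by move=> c S T [? ?] [? ?]; split; [exact: l1|exact: l2].
Qed.

Lemma vn_memP T : M T <->
  bounded_op T /\ forall S, commutant M S -> forall v, T (S v) = S (T v).
Proof. by case: hM => _ _ {1}<-; exact: commutantP. Qed.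

Lemma center_commute T S v : vn_center M T -> M S -> T (S v) = S (T v).
Proof. by move=> [_ /commutantP[_ h]] MS; exact: h. Qed.

Lemma centerP T : vn_center M T <-> bounded_op T /\
  forall S, M S \/ commutant M S -> forall v, T (S v) = S (T v).
Proof.
split=> [[/vn_memP[bT c1] /commutantP[_ c2]]|[bT c]].
  by split=> // S [MS|MS] v; [exact: c2|exact: c1].
split; first by apply/vn_memP; split=> // S cS; apply: c; right.
by apply/commutantP; split=> // S cS; apply: c; left.
Qed.

(** Everything in [M] and in its commutant commutes with a central [K]. *)
Lemma center_bicommutant K T : vn_center M K -> bounded_op T ->
  (forall W, bounded_op W -> (forall v, W (K v) = K (W v)) ->
     forall v, T (W v) = W (T v)) -> vn_center M T.
Proof.
move=> /centerP[bK cK] bT h; apply/centerP; split=> // S hS; apply: h.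
  by case: hS => [/(oa_bounded vn_algebra)|/(oa_bounded vn_commutant_algebra)].
by move=> v; rewrite cK.
Qed.

(** The kernel of [K] is invariant under every operator commuting with [K], and
    under the adjoint of such an operator. *)
Lemma ker_proj K : vn_center M K -> adjoint_pair K K ->
  exists P, [/\ central_proj M P, (forall v, K (P v) = 0) &
    forall v, K v = 0 -> P v = v].
Proof.
move=> zK sK; have bK := oa_bounded center_algebra zK.
have /bounded_opP[lK [k k0 hk]] := bK.
pose D := [set v | K v = 0].
have sD : lin_subspace D.
  split; first exact: lin0.
  by move=> c u v; rewrite /D /= lK => -> ->; rewrite scaler0 addr0.
have cD : closed D.
  move=> v /closure_hnormP hv; apply: hnorm_eq0; apply/eqP.
  rewrite eq_le hnorm_ge0 andbT; apply/ler_addgt0Pr => e e0.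
  have [|u Du ue] := hv (e / k); first by rewrite divr_gt0.
  have -> : K v = K (v - u) by rewrite (linB lK) Du subr0.
  rewrite add0r; apply: le_trans (hk _) _.
  by rewrite hnormBC -ler_pdivlMl// mulrC ltW.
have [P hP] := proj_exists cD sD; have [lP DP fP aP _] := hP.
have zP : vn_center M P.
  apply: (center_bicommutant zK (proj_bounded hP)) => W bW cW.
  have [W' bW' aW] := adjoint_exists bW.
  apply: (proj_commute sD hP (bounded_lin bW) aW) => v; rewrite /D /=.
    by move=> h; rewrite -cW h lin0//; exact: bounded_lin.
  move=> h; rewrite -(adjoint_commute aW sK cW) h lin0//; exact: bounded_lin.
exists P; split=> //; split=> //; split=> //; first by case: zP.
by apply/funext => v /=; apply: fP.
Qed.

Definition min_central e := central_proj M e /\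
  forall z, central_proj M z -> (forall v, z (e v) = 0) \/ (forall v, z (e v) = e v).

Lemma cproj_idem e v : central_proj M e -> e (e v) = e v.
Proof. by move=> [[_ /(congr1 (@^~ v))]]. Qed.

Lemma cproj_sym e : central_proj M e -> adjoint_pair e e.
Proof. by move=> [[]]. Qed.

Lemma cproj_linear e : central_proj M e -> linear e.
Proof. by move=> [[/(oa_linear vn_algebra)]]. Qed.

Lemma cproj_mem e : central_proj M e -> M e.
Proof. by move=> [[]]. Qed.

Lemma cproj_center e : central_proj M e -> vn_center M e.
Proof. by case. Qed.

(** The projection onto the kernel of [|A| - A] is central, so the minimal [e]
    lies below it, where [A = |A|], or is orthogonal to it, where [A = - |A|]. *)
Lemma min_central_signed e A : min_central e -> vn_center M A -> adjoint_pair A A ->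
  (forall v, 0 <= ip (A (e v)) (e v)) \/ (forall v, ip (A (e v)) (e v) <= 0).
Proof.
move=> [ce me] zA sA; have bA := oa_bounded center_algebra zA.
have lA := bounded_lin bA.
have [|||S [bS sS pS SS cS]] := @positive_sqrt _ _ (fun v => A (A v)).
- exact: bounded_comp.
- by move=> u v; rewrite !sA.
- by move=> v; rewrite sA ip_ge0.
have zS : vn_center M S.
  apply: (center_bicommutant (oa_comp center_algebra zA zA) bS) => W bW cW v.
  by rewrite cS.
have lS := bounded_lin bS.
have [|P [cP KP fP]] := ker_proj (oa_sub center_algebra zS zA).
  by move=> u v; rewrite ipBl ipBr sS sA.
have [Pe|Pe] := me P cP; [right|left] => v.
  have eA : A (e v) = e (A v) := center_commute v zA (cproj_mem ce).
  have eS : S (e v) = e (S v) := center_commute v zS (cproj_mem ce).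
  have : P (S (e v) + A (e v)) = S (e v) + A (e v).
    apply: fP; rewrite (linD lS) (linD lA) SS.
    by rewrite -(cS A bA) => [|w //]; vec.
  rewrite {1}eS {1}eA -(linD (cproj_linear ce)) Pe => /esym/eqP.
  rewrite addr_eq0 => /eqP h.
  by rewrite -oppr_ge0 -ipNl -h.
have := KP (e v); rewrite Pe => /subr0_eq <-.
exact: pS.
Qed.

(** By the sign alternative for [T - l], every real [l] lies on one side of all
    the values [<T v, v> / |v| ^ 2] on the range of [e]; these values are therefore
    all equal. *)
Lemma min_central_scalar_sym e T : min_central e -> vn_center M T ->
  adjoint_pair T T -> exists c, forall v, T (e v) = c *: e v.
Proof.
move=> me zT sT; have [ce _] := me.
have lT := oa_linear center_algebra zT.
pose q v := complex.Re (ip (T (e v)) (e v)).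
have qE v : ip (T (e v)) (e v) = (q v)%:C by rewrite /q RRe_real// symmetric_real.
have dich (l : R) : (forall v, l * hnorm (e v) ^+ 2 <= q v) \/
    (forall v, q v <= l * hnorm (e v) ^+ 2).
  have zA : vn_center M (fun v => T v - l%:C *: v).
    apply: (oa_sub center_algebra) => //; apply: (oa_scale center_algebra).
    exact: (oa_id center_algebra).
  have [|h|h] := min_central_signed me zA.
  - by move=> u v; rewrite ipBl ipBr ipZl ipZr realC_conj sT.
  - left=> v; have := h v.
    by rewrite ipBl ipZl ip_hnorm qE -realCM -realCB lecR subr_ge0.
  - right=> v; have := h v.
    by rewrite ipBl ipZl ip_hnorm qE -realCM -realCB lecR subr_le0.
have [h|/existsNP[v0 hv0]] := pselect (forall v, e v = 0).
  by exists 0 => v; rewrite h scaler0 (lin0 lT).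
have n0 : 0 < hnorm (e v0) ^+ 2.
  by rewrite exprn_gt0// lt_def hnorm_ge0 andbT; apply/eqP => /hnorm_eq0.
pose l0 := q v0 / hnorm (e v0) ^+ 2.
have l0E : q v0 = l0 * hnorm (e v0) ^+ 2 by rewrite /l0 divfK// gt_eqF.
have form v : q v = l0 * hnorm (e v) ^+ 2.
  have [z|ev] := eqVneq (e v) 0.
    by rewrite /q z (lin0 lT) ip0l hnorm0 expr0n /= mulr0.
  have n1 : 0 < hnorm (e v) ^+ 2.
    rewrite exprn_gt0// lt_def hnorm_ge0 andbT.
    by apply: contra ev => /eqP/hnorm_eq0 ->.
  pose l1 := q v / hnorm (e v) ^+ 2.
  have l1E : q v = l1 * hnorm (e v) ^+ 2 by rewrite /l1 divfK// gt_eqF.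
  rewrite l1E; congr (_ * _).
  have [h|h] := dich ((l0 + l1) / 2).
  - have := h v; have := h v0; rewrite l0E l1E !ler_pM2r//; lra.
  - have := h v; have := h v0; rewrite l0E l1E !ler_pM2r//; lra.
exists l0%:C => v; apply/subr0_eq.
have eT w : T (e w) = e (T w) := center_commute w zT (cproj_mem ce).
have le := cproj_linear ce; have se := cproj_sym ce.
have form0 w : ip (T (e w) - l0%:C *: e w) w = 0.
  have -> : T (e w) - l0%:C *: e w = e (T (e w) - l0%:C *: e w).
    by rewrite (linB le) (linZ le) -eT !(cproj_idem _ ce).
  by rewrite se ipBl ipZl qE ip_hnorm form realCM subrr.
apply: (@positive_form0 _ _ (fun w => T (e w) - l0%:C *: e w)).
- by move=> c u w; rewrite le lT; vec.
- by move=> u w; rewrite ipBl ipBr ipZl ipZr realC_conj sT !se eT.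
- by move=> w; rewrite form0.
- exact: form0.
Qed.

Lemma center_adjoint T S : vn_center M T -> adjoint_pair T S -> vn_center M S.
Proof.
move=> zT aTS; have /centerP[bT cT] := zT.
have [_ adjM _] := hM.
have bS := adjoint_bounded bT aTS.
have [S' MS' aS'] : exists2 S', M S' & adjoint_pair T S' by apply: adjM; case: zT.
have SE : S' = S by apply/funext => v; apply: ip_injr => u; rewrite -aS' aTS.
rewrite SE in MS'; split=> //; apply/commutantP; split=> // W MW v.
have [W' MW' aW] := adjM W MW.
apply: ip_injr => u; rewrite -aTS -(adjoint_sym aW) -(adjoint_sym aW) -aTS.
by rewrite cT//; left.
Qed.

(** Split [T] into its real part and its imaginary part. *)
Lemma min_central_scalar e T : min_central e -> vn_center M T ->
  exists c, forall v, T (e v) = c *: e v.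
Proof.
move=> me zT; have lT := oa_linear center_algebra zT.
have [_ adjM _] := hM.
have [S MS aTS] := adjM T (proj1 zT).
have zS := center_adjoint zT aTS; have lS := oa_linear center_algebra zS.
have aST := adjoint_sym aTS.
have [|a ha] := min_central_scalar_sym me (oa_add center_algebra zT zS).
  by move=> u v; rewrite ipDl ipDr aTS aST addrC.
have zD : vn_center M (fun v => 'i%C *: (T v - S v)).
  by apply: (oa_scale center_algebra); exact: (oa_sub center_algebra).
have [|b hb] := min_central_scalar_sym me zD.
  move=> u v; rewrite ipZl ipZr ipBl ipBr aTS aST.
  have -> : cj 'i%C = - 'i%C by apply/eqP; rewrite eq_complex /= oppr0 !eqxx.
  by ring.
exists ((a - 'i%C * b) / 2) => v.
have i2 : 'i%C * 'i%C = -1 :> R[i] by rewrite -expr2 sqr_i.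
have -> : T (e v) = 2^-1 *:
    ((T (e v) + S (e v)) - 'i%C *: ('i%C *: (T (e v) - S (e v)))).
  rewrite scalerA i2 scaleN1r opprK.
  apply: ip_inj => w; rewrite ipZl !ipDl ipNl.
  by field.
by rewrite ha hb; apply: ip_inj => w; rewrite !(ipZl, ipDl, ipNl); field.
Qed.

End VonNeumann.
End OperatorAlgebras.

(** * Graphs of bounded operators and an unbounded element of the central extension *)

Section Graphs.
Context {R : realType} {H : hilbertType R}.
Implicit Types (u v w : H) (c : R[i]) (T S W p q z e : H -> H) (M N : set (H -> H)).
Implicit Types x y : oper H.

Local Notation ip := (inner H).

Lemma closed_eqop S T : bounded_op S -> bounded_op T ->
  closed [set v : H * H | S v.2 = T v.1].
Proof.
move=> /bounded_opP[lS [k k0 hk]] /bounded_opP[lT [l l0 hl]] v /closure_graphP hv.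
apply/subr0_eq/hnorm_eq0/eqP; rewrite eq_le hnorm_ge0 andbT.
apply/ler_addgt0Pr => e e0.
have [|u /= Su [u1 u2]] := hv (e / (k + l)); first by rewrite divr_gt0// addr_gt0.
have -> : S v.2 - T v.1 = - S (u.2 - v.2) + T (u.1 - v.1).
  by rewrite (linB lS) (linB lT) Su; vec.
have := hnorm_triangle (- S (u.2 - v.2)) (T (u.1 - v.1)); rewrite hnorm_opp.
have := hk (u.2 - v.2); have := hl (u.1 - v.1).
have eE : e / (k + l) * (k + l) = e by rewrite divfK// gt_eqF// addr_gt0.
move: u1 u2 eE; move: (hnorm _) (hnorm _) (hnorm _) (hnorm _) (hnorm _) (e / _).
move=> *; nra.
Qed.

Lemma closed_op_graph T : bounded_op T -> closed (op_graph T).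
Proof.
move=> bT; have := closed_eqop bounded_id bT.
by congr closed; apply/seteqP.
Qed.

Lemma linear_op_graph T : linear T -> linear_op (op_graph T).
Proof.
move=> lT; split; first by rewrite /op_graph /= (lin0 lT).
- by move=> c [u1 u2] [v1 v2]; rewrite /op_graph /= => -> ->; rewrite lT.
- by move=> xi eta eta'; rewrite /op_graph /= => -> ->.
Qed.

Lemma closure_op_graph T : bounded_op T -> closure (op_graph T) = op_graph T.
Proof. by move=> bT; apply/esym/closure_id/closed_op_graph. Qed.

Lemma strong_sum_graph S T : bounded_op S -> bounded_op T ->
  strong_sum (op_graph S) (op_graph T) = op_graph (fun v => S v + T v).
Proof.
move=> bS bT; rewrite /strong_sum.
rewrite (_ : sum_op _ _ = op_graph (fun v => S v + T v)).
  apply: closure_op_graph.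
  rewrite (_ : (fun _ => _) = (fun v => 1 *: S v + T v)); first exact: bounded_comb.
  by apply/funext => v; rewrite scale1r.
apply/seteqP; split=> -[xi eta]; rewrite /sum_op /op_graph /=.
  by move=> [a [b [-> -> ->]]].
by move=> ->; exists (S xi), (T xi).
Qed.

Lemma prod_op_graph S T :
  prod_op (op_graph S) (op_graph T) = op_graph (fun v => S (T v)).
Proof.
apply/seteqP; split=> -[xi eta]; rewrite /prod_op /op_graph /=.
  by move=> [a -> ->].
by move=> ->; exists (T xi).
Qed.

Lemma strong_prod_graph S T : bounded_op S -> bounded_op T ->
  strong_prod (op_graph S) (op_graph T) = op_graph (fun v => S (T v)).
Proof.
move=> bS bT; rewrite /strong_prod prod_op_graph.
exact/closure_op_graph/bounded_comp.
Qed.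

Lemma bounded_scale c T : bounded_op T -> bounded_op (fun v => c *: T v).
Proof.
move=> bT; rewrite (_ : (fun _ => _) = (fun v => (c - 1) *: T v + T v)).
  exact: bounded_comb.
by apply/funext => v; rewrite scalerBl scale1r subrK.
Qed.

Lemma strong_scale_graph c T : bounded_op T ->
  strong_scale c (op_graph T) = op_graph (fun v => c *: T v).
Proof.
by move=> bT; apply: (strong_prod_graph (bounded_scale c bounded_id) bT).
Qed.

Lemma op_graph_inj S T : op_graph S = op_graph T -> S = T.
Proof.
move=> h; apply/funext => v; have : op_graph S (v, S v) by [].
by rewrite h.
Qed.

Lemma adj_op_graph S T : adjoint_pair T S -> adj_op (op_graph T) = op_graph S.
Proof.
move=> aTS; apply/seteqP; split=> -[xi eta]; rewrite /adj_op /op_graph /=.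
  move=> h; apply: ip_injr => u; rewrite -aTS.
  by have /= <- := h (u, T u) erefl.
by move=> -> [u w] /= ->.
Qed.

Lemma positive_op_graph T : linear T -> adjoint_pair T T ->
  (forall v, 0 <= ip (T v) v) -> positive_op (op_graph T).
Proof.
move=> lT sT pT; split; first exact: linear_op_graph.
  exact: adj_op_graph.
by move=> [u w]; rewrite /op_graph /= => ->.
Qed.

Lemma op_le_graph S T : bounded_op S -> bounded_op T ->
  op_le (op_graph S) (op_graph T) = positive_op (op_graph (fun v => T v - S v)).
Proof.
move=> bS bT; rewrite /op_le strong_scale_graph// strong_sum_graph//.
  by congr (positive_op (op_graph _)); apply/funext => v; rewrite scaleN1r.
exact: bounded_scale.
Qed.

Lemma sup_one_id N (I : Type) (i : I) : sup_one N (fun _ : I => @id H).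
Proof.
move=> q [_ qq _] /(_ i) h; apply/funext => v.
have [w _ <-] : range q v by apply: h; exists v.
by have /(congr1 (@^~ w)) := qq.
Qed.

(** The domain is everything, so the constant sequence of identities witnesses
    strong density. *)
Lemma measurable_graph N T : op_algebra N -> N T -> measurable_op N (op_graph T).
Proof.
move=> aN NT; have bT := oa_bounded aN NT.
have N0 := oa_0 aN; have N1 := oa_id aN.
have p0 : perp (@id H) = fun _ => 0 by apply/funext => v; rewrite /perp /= subrr.
have dom v : domain (op_graph T) v by exists (T v).
split.
- by split; [exact: linear_op_graph (bounded_lin bT)|exact: closed_op_graph].
- split; first by move=> u _ _ v _; exact: dom.
  move=> u /commutantP[_ cu] _ xi eta; rewrite /op_graph /= => ->.
  by rewrite cu.
- split; first by move=> u _ _ v _; exact: dom.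
  have idp : projection N (@id H) by split.
  exists (fun _ => id); split=> //.
    by split; [move=> n v|exact: (@sup_one_id N nat 0%N)].
    by move=> _ v _; exact: dom.
  move=> _; rewrite p0; split.
    by split=> // u v; rewrite ip0l ip0r.
  move=> q _ qle _; apply/funext => v.
  by have [w _ <-] : range (fun _ : H => 0 : H) (q v) by apply: qle; exists v.
Qed.

Lemma cproj_id M : von_neumann M -> central_proj M (@id H).
Proof.
move=> hM; have zid := oa_id (center_algebra hM); split=> //.
by split=> //; case: zid.
Qed.

Lemma graph_central_extension M T : von_neumann M -> M T ->
  central_extension M (op_graph T).
Proof.
move=> hM MT; have mT := measurable_graph (vn_algebra hM) MT.
have bT := oa_bounded (vn_algebra hM) MT.
have e : strong_prod (op_graph id) (op_graph T) = op_graph T.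
  exact: strong_prod_graph bounded_id bT.
split.
  have [c a _] := mT; split=> //; exists (fun _ => id); split.
  - by move=> _; exact: cproj_id.
  - by split; [move=> n v|exact: (@sup_one_id M nat 0%N)].
  - by move=> _; rewrite e.
exists unit, (fun _ => id); split.
- by move=> _; exact: cproj_id.
- by move=> [] [].
- exact: (@sup_one_id M unit tt).
- by move=> _; rewrite e; exists T.
Qed.

(** Closing the graph of a restriction of [C] to a dense domain gives back [C]. *)
Lemma dense_domain_prod x z C : bounded_op C ->
  (forall xi eta, x (xi, eta) -> z eta = C xi) ->
  (forall v (d : R), 0 < d -> exists2 u, domain x u & hnorm (u - v) < d) ->
  strong_prod (op_graph z) x = op_graph C.
Proof.
move=> bC zx dx; have sub : prod_op (op_graph z) x `<=` op_graph C.
  by move=> [xi eta] [w /= xw]; rewrite /op_graph /= => ->; exact: zx.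
apply/seteqP; split.
  by move/closureS: sub; rewrite closure_op_graph.
move=> [xi eta]; rewrite {1}/op_graph /= => ->; apply/closure_graphP => e e0.
have /bounded_opP[lC [k k0 hk]] := bC.
have [|u [w xu] hu] := dx xi (Num.min e (e / k)); first by rewrite lt_min e0 divr_gt0.
exists (u, z w); first by exists w.
move: hu; rewrite lt_min => /andP[h1 h2] /=; split=> //.
rewrite (zx _ _ xu) -(linB lC); apply: le_lt_trans (hk _) _.
by rewrite mulrC -ltr_pdivlMr.
Qed.

End Graphs.

Section CentralProjections.
Context {R : realType} {H : hilbertType R} {M : set (H -> H)}.
Hypothesis hM : von_neumann M.
Implicit Types (u v w : H) (c : R[i]) (T S W p q z e : H -> H).

Local Notation ip := (inner H).

Let idem e v : central_proj M e -> e (e v) = e v.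
Proof. by move=> ce; exact: (cproj_idem v ce). Qed.

Lemma cprojP e : central_proj M e <->
  [/\ vn_center M e, (forall v, e (e v) = e v) & adjoint_pair e e].
Proof.
split=> [ce|[ze ie se]].
  split; [exact: cproj_center| |exact: (cproj_sym ce)].
  by move=> v; exact: (cproj_idem v ce).
split=> //; split=> //; first by case: ze.
by apply/funext => v /=.
Qed.

Lemma cproj_commute e T v : central_proj M e -> M T -> e (T v) = T (e v).
Proof. by move=> /cproj_center ze MT; exact: (center_commute v ze MT). Qed.

Lemma cproj_add e p : central_proj M e -> central_proj M p ->
  (forall v, e (p v) = 0) -> central_proj M (fun v => e v + p v).
Proof.
move=> ce cp ep; apply/cprojP; split.
- by apply: (oa_add (center_algebra hM)); exact: cproj_center.
- move=> v; have pe : p (e v) = 0 by rewrite (cproj_commute _ cp (cproj_mem ce)).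
  rewrite (linD (cproj_linear hM ce)) (linD (cproj_linear hM cp)) !idem//.
  by rewrite ep pe addr0 add0r.
- by move=> u v; rewrite ipDl ipDr (cproj_sym ce) (cproj_sym cp).
Qed.

Lemma cproj_sub e p : central_proj M e -> central_proj M p ->
  (forall v, e (p v) = p v) -> central_proj M (fun v => e v - p v).
Proof.
move=> ce cp ep; apply/cprojP; split.
- by apply: (oa_sub (center_algebra hM)); exact: cproj_center.
- move=> v; have pe : p (e v) = p v by rewrite (cproj_commute _ cp (cproj_mem ce)).
  rewrite (linB (cproj_linear hM ce)) (linB (cproj_linear hM cp)) !idem//.
  by rewrite ep pe subrr subr0.
- by move=> u v; rewrite ipBl ipBr (cproj_sym ce) (cproj_sym cp).
Qed.

Lemma cproj_comp e p : central_proj M e -> central_proj M p ->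
  central_proj M (fun v => e (p v)).
Proof.
move=> ce cp; have ep v : e (p v) = p (e v).
  exact: (cproj_commute _ ce (cproj_mem cp)).
apply/cprojP; split.
- by apply: (oa_comp (center_algebra hM)); exact: cproj_center.
- by move=> v; rewrite -(ep (p v)) !idem.
- by move=> u v; rewrite (cproj_sym ce) (cproj_sym cp) ep.
Qed.

Lemma cproj_0 : central_proj M (fun _ => 0).
Proof.
apply/cprojP; split=> //; first exact: oa_0 (center_algebra hM).
by move=> u v; rewrite ip0l ip0r.
Qed.

Lemma cproj_sum (f : nat -> H -> H) n : (forall i, (i < n)%N -> central_proj M (f i)) ->
  (forall i j v, (i < n)%N -> (j < n)%N -> i != j -> f i (f j v) = 0) ->
  central_proj M (fun v => \sum_(i < n) f i v).
Proof.
elim: n => [|n ih] cf of_.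
  by under eq_fun do rewrite big_ord0; exact: cproj_0.
under eq_fun do rewrite big_ord_recr /=.
apply: cproj_add.
- apply: ih => [i hi|i j v hi hj]; first by apply: cf; rewrite ltnS ltnW.
  by apply: of_; rewrite ltnS ltnW.
- exact: cf.
- move=> v; rewrite big1// => i _; apply: of_ => //.
    by rewrite ltnS ltnW.
  by rewrite ltn_eqF.
Qed.

(** If [q] lies above every [f i], then [v - q v] is in their joint kernel. *)
Lemma sup_one_kernel (I : Type) (f : I -> H -> H) :
  (forall i, central_proj M (f i)) -> (forall v, (forall i, f i v = 0) -> v = 0) ->
  sup_one M f.
Proof.
move=> cf kf q [Mq qq sq] hq; apply/funext => v; apply/esym/subr0_eq/kf => i.
rewrite (linB (cproj_linear hM (cf i))) (cproj_commute _ (cf i) Mq).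
have [w _ <-] : range q (f i v) by apply: hq; exists v.
by have /(congr1 (@^~ w)) /= -> := qq; rewrite subrr.
Qed.

(** The closed operator acting as multiplication by [n] on the range of [f n]
    is in the central extension, and it is unbounded. *)
Lemma unbounded_central_extension (f : nat -> H -> H) :
  (forall n, central_proj M (f n)) ->
  (forall m n v, m != n -> f m (f n v) = 0) ->
  (forall v, (forall n, f n v = 0) -> v = 0) ->
  (forall n, exists v, f n.+1 v <> 0) ->
  exists2 x, central_extension M x & ~ (op_graph @` M) x.
Proof.
move=> cf of_ kf nf.
have lf n := cproj_linear hM (cf n).
have bf n : bounded_op (f n) by apply: (oa_bounded (vn_algebra hM)); exact: cproj_mem.
pose x : oper H := [set v | forall n, f n v.2 = n%:R *: f n v.1].
have xf n v : x (f n v, n%:R *: f n v).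
  move=> m /=; rewrite (linZ (lf m)); have [->//|mn] := eqVneq m n.
  by rewrite of_// !scaler0.
have linx : linear_op x.
  split.
  - by move=> n /=; rewrite (lin0 (lf n)) scaler0.
  - move=> c u v xu xv n /=; rewrite !lf xu xv.
    by rewrite scalerDr !scalerA mulrC.
  - move=> xi eta eta' h h'; apply/subr0_eq/kf => n.
    by rewrite (linB (lf n)) (h n) (h' n) subrr.
have clx : closed x.
  move=> v cv n; apply: (closed_eqop (bf n) (bounded_scale n%:R (bf n))).
  by apply: closureS cv => u; exact.
have affx : affiliated M x.
  have h (u : H -> H) : commutant M u -> forall xi eta, x (xi, eta) -> x (u xi, u eta).
    move=> cu xi eta hx n /=; have /commutantP[bu cu'] := cu.
    have e w : f n (u w) = u (f n w) by rewrite cu'//; exact: cproj_mem.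
    by rewrite !e (hx n) /= (linZ (bounded_lin bu)).
  split; last by move=> u cu _; exact: h.
  by move=> u cu _ w [xi [eta hx] <-]; exists (u eta); exact: h.
have domx : forall v (d : R), 0 < d -> exists2 u, domain x u & hnorm (u - v) < d.
  apply: dense_subspace.
    split; first by exists 0; case: linx.
    move=> c u v [u' hu] [v' hv]; exists (c *: u' + v').
    by case: linx => _ h _; have := h c _ _ hu hv.
  move=> w hw; apply: kf => n; apply: ip_injr => v; rewrite ip0r.
  rewrite -(cproj_sym (cf n)); apply: hw; exists (n%:R *: f n v); exact: xf.
pose z n v := \sum_(i < n) f i v.
have cz n : central_proj M (z n) by apply: cproj_sum => // i j v _ _; exact: of_.
pose C n v := \sum_(i < n) i%:R *: f i v.
have MC n : M (C n).
  apply: (oa_sum (vn_algebra hM)) => i _; apply: (oa_scale (vn_algebra hM)).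
  exact: cproj_mem.
have zx n : strong_prod (op_graph (z n)) x = op_graph (C n).
  apply: dense_domain_prod => //; first exact: (oa_bounded (vn_algebra hM)).
  by move=> xi eta hx; apply: eq_bigr => i _; exact: hx.
have fz n v : z n.+1 (f n v) = f n v.
  rewrite /z big_ord_recr /= idem// big1 ?add0r// => i _.
  by rewrite of_// ltn_eqF.
exists x; last first.
  move=> [T MT xT]; have /bounded_opP[lT [k k0 hk]] := oa_bounded (vn_algebra hM) MT.
  (* An integer exceeding the bound [k] of [T] contradicts [T = n] on the range of
     [f n]. *)
  pose n := (Num.truncn k).+1.
  have kn : k < n%:R by rewrite truncnS_gt.
  have [v /eqP fv] := nf (Num.truncn k); rewrite -/n in fv.
  have Tf : T (f n v) = n%:R *: f n v by have := xf n v; rewrite -xT.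
  have := hk (f n v); rewrite Tf (_ : n%:R = (n%:R : R)%:C); last by rewrite rmorph_nat.
  rewrite hnormZr ger0_norm// ler_pM2r; first by rewrite leNgt kn.
  by rewrite lt_def hnorm_ge0 andbT; apply: contra fv => /eqP/hnorm_eq0 ->.
split.
  split=> //; exists z; split=> //.
    split.
      move=> n _ [v _ <-]; exists (z n v) => //.
      rewrite /z big_ord_recr /= -/(z n (z n v)) idem//.
      rewrite (lin_sum (lf n)) big1 ?addr0// => i _.
      by rewrite of_// gtn_eqF.
    apply: sup_one_kernel => // v hv; apply: kf => n.
    have := hv n.+1; have := hv n; rewrite /z big_ord_recr /= => ->.
    by rewrite add0r.
  by move=> n; rewrite zx; apply: measurable_graph => //; exact: vn_algebra.
exists nat, f; split=> //.
- by move=> i j /eqP ij; apply/funext => v /=; exact: of_.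
- exact: sup_one_kernel.
- move=> n; exists (fun v => n%:R *: f n v).
    by apply: (oa_scale (vn_algebra hM)); exact: cproj_mem.
  by apply/esym/dense_domain_prod => //; exact: bounded_scale.
Qed.

End CentralProjections.

(** * Atoms of the centre *)

Section Atoms.
Context {R : realType} {H : hilbertType R} {M : set (H -> H)}.
Hypothesis hM : von_neumann M.
Implicit Types (u v w : H) (c : R[i]) (T S W p q z e a b : H -> H).

Local Notation ip := (inner H).

Let idem e v : central_proj M e -> e (e v) = e v.
Proof. by move=> ce; exact: (cproj_idem v ce). Qed.

(** The projection onto the common range: an operator commuting with all the
    [s n] leaves it invariant, and so does its adjoint. *)
Lemma cproj_inf (s : nat -> H -> H) : (forall n, central_proj M (s n)) ->
  exists p, [/\ central_proj M p, (forall n v, s n (p v) = p v) &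
    forall v, (forall n, s n v = v) -> p v = v].
Proof.
move=> cs; pose D := [set v | forall n, s n v = v].
have ls n := cproj_linear hM (cs n).
have sD : lin_subspace D.
  split; first by move=> n; exact: lin0.
  by move=> c u v hu hv n; rewrite ls hu hv.
have cD : closed D.
  move=> v /closure_hnormP hv n; apply/subr0_eq/hnorm_eq0/eqP.
  have /bounded_opP[_ [k k0 hk]] := oa_bounded (vn_algebra hM) (cproj_mem (cs n)).
  rewrite eq_le hnorm_ge0 andbT; apply/ler_addgt0Pr => e e0; rewrite add0r.
  have [|u Du ue] := hv (e / (k + 1)); first by rewrite divr_gt0// addr_gt0.
  have -> : s n v - v = (u - v) - s n (u - v) by rewrite (linB (ls n)) Du; vec.
  have := hnorm_triangle (u - v) (- s n (u - v)); rewrite hnorm_opp.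
  move: ue; rewrite ltr_pdivlMr ?addr_gt0//.
  by have := hk (u - v); move: (hnorm _) (hnorm _) (hnorm _) => *; nra.
have [P hP] := proj_exists cD sD; have [lP DP fP aP _] := hP.
exists P; split; [apply/(cprojP)|by move=> n v; exact: DP|exact: fP].
split=> //; last by move=> v; exact: fP.
apply/(centerP hM); split; first exact: proj_bounded hP.
move=> W hW.
have bW : bounded_op W.
  by case: hW => [/(oa_bounded (vn_algebra hM))|[]].
have cW n v : W (s n v) = s n (W v).
  by have /(centerP hM)[_ h] := cproj_center (cs n); rewrite h.
have [W' bW' aW] := adjoint_exists bW.
apply: (proj_commute sD hP (bounded_lin bW) aW) => v hv n.
  by rewrite -cW hv.
by rewrite -(adjoint_commute aW (cproj_sym (cs n)) (cW n)) hv.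
Qed.

(** Finite orthogonal sums of nonzero minimal central projections. They are
    generated one summand at a time so that closure under orthogonal sums, hence
    the splitting of a non-atomic projection, needs no bookkeeping of indices. *)
Inductive atomic : (H -> H) -> Prop :=
| Atomic0 : atomic (fun _ => 0)
| AtomicS e z : min_central M e -> (exists v, e v <> 0) -> atomic z ->
    (forall v, e (z v) = 0) -> atomic (fun v => e v + z v).

Lemma atomic_cproj z : atomic z -> central_proj M z.
Proof.
elim=> [|e {}z [ce _] _ _ cz ez]; first exact: (cproj_0 hM).
exact: cproj_add.
Qed.

Lemma atomic_add a b : atomic a -> atomic b -> (forall v, a (b v) = 0) ->
  atomic (fun v => a v + b v).
Proof.
move=> ha hb; have cb := atomic_cproj hb.
elim: ha => [|e z me ne hz ih ez] ab.
  by rewrite (_ : (fun _ => _) = b)//; apply/funext => v; rewrite add0r.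
have ce := me.1; have cz := atomic_cproj hz.
have le := cproj_linear hM ce.
have eb v : e (b v) = 0.
  by have := congr1 e (ab v); rewrite (linD le) idem// ez addr0 (lin0 le).
have zb v : z (b v) = 0 by have := ab v; rewrite eb add0r.
rewrite (_ : (fun _ => _) = (fun v => e v + (z v + b v))); last first.
  by apply/funext => v; rewrite addrA.
by apply: AtomicS => // [|v]; [exact: ih|rewrite (linD le) ez eb addr0].
Qed.

(** Being neither zero nor minimal, [z] is cut by some central [p] into two
    nonzero pieces, which are not both atomic. *)
Lemma non_atomic_split z : central_proj M z -> ~ atomic z ->
  exists z', [/\ central_proj M z', ~ atomic z', (forall v, z (z' v) = z' v) &
    exists v, z v - z' v <> 0].
Proof.
move=> cz nz; have lz := cproj_linear hM cz.
have z0 : exists v, z v <> 0.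
  apply: contrapT => h; apply: nz; rewrite (_ : z = fun _ => 0); first exact: Atomic0.
  by apply/funext => v; apply: contrapT => h'; apply: h; exists v.
have : ~ min_central M z.
  move=> mz; apply: nz; rewrite (_ : z = fun v => z v + 0).
    by apply: AtomicS => //; [exact: Atomic0|move=> v; rewrite lin0].
  by apply/funext => v; rewrite addr0.
move=> /not_andP[//|/existsNP[p /not_implyP[cp]]].
move=> /not_orP[/existsNP[v1 n1] /existsNP[v2 n2]].
have pz v : p (z v) = z (p v) by exact: (cproj_commute _ cp (cproj_mem cz)).
pose a v := p (z v); pose b v := z v - p (z v).
have ca : central_proj M a by exact: cproj_comp.
have za v : z (a v) = a v by rewrite /a -pz idem.
have cb : central_proj M b by exact: cproj_sub.
have [ha|ha] := pselect (atomic a); last first.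
  exists a; split=> //; exists v2; rewrite /a => /subr0_eq h; exact: n2.
have [hb|hb] := pselect (atomic b); last first.
  exists b; split=> //; first by move=> v; rewrite /b (linB lz) za idem.
  by exists v1; rewrite /b subKr.
exfalso; apply: nz; rewrite (_ : z = fun v => a v + b v).
  apply: atomic_add => // v; rewrite /a /b (linB lz) idem//.
  rewrite (linB (cproj_linear hM cp)) -/(a v) za /a.
  by rewrite idem// subrr.
by apply/funext => v; rewrite /b addrC subrK.
Qed.

(** Otherwise the identity could be split for ever, and the successive
    differences, together with what lies below all of them, would support an
    unbounded element of the central extension. *)
Lemma identity_atomic : central_extension M = op_graph @` M -> atomic id.
Proof.
move=> hE; apply: contrapT => nid.
have /choice[nxt hnxt] (z : {z : H -> H | central_proj M z /\ ~ atomic z}) :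
    exists z' : {z : H -> H | central_proj M z /\ ~ atomic z},
    (forall v, sval z (sval z' v) = sval z' v) /\ exists v, sval z v - sval z' v <> 0.
  case: z => z [cz nz] /=; have [z' [cz' nz' zz' h]] := non_atomic_split cz nz.
  by exists (exist _ z' (conj cz' nz')).
pose s n := sval (iter n nxt (exist _ (@id H) (conj (cproj_id hM) nid))).
have cs n : central_proj M (s n).
  by rewrite /s; case: (iter _ _ _) => z [].
have sS n v : s n (s n.+1 v) = s n.+1 v by exact: (proj1 (hnxt _) v).
have sN n : exists v, s n v - s n.+1 v <> 0 by exact: (proj2 (hnxt _)).
have ls n := cproj_linear hM (cs n).
have sm m n v : (m <= n)%N -> s m (s n v) = s n v.
  move=> /subnKC <-; elim: (n - m)%N v => [|k ih] v; first by rewrite addn0 idem.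
  by rewrite addnS -(sS (m + k)%N) ih.
have [p [cp sp fp]] := cproj_inf cs.
pose d n v := s n v - s n.+1 v.
have cd n : central_proj M (d n) by apply: cproj_sub.
have ld n := cproj_linear hM (cd n).
have dp n v : d n (p v) = 0 by rewrite /d !sp subrr.
have dd m n v : (m < n)%N -> d m (d n v) = 0.
  by move=> mn; rewrite /d !(linB (ls _)) !sm ?subrr// ltnW// ltnS ltnW.
(* [p] completes the differences: if all of them kill [v], then every [s n]
   fixes [v]. *)
pose f n := if n is m.+1 then d m else p.
have [||||x xE xn] := @unbounded_central_extension _ _ _ hM f.
- by case.
- have comm m n v : central_proj M (f m) -> central_proj M (f n) ->
      f m (f n v) = f n (f m v).
    by move=> c1 c2; exact: (cproj_commute _ c1 (cproj_mem c2)).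
  have cf n : central_proj M (f n) by case: n.
  have lt m n v : (m < n)%N -> f m (f n v) = 0.
    case: n => // n; case: m => [_|m]; first by rewrite comm//= dp.
    by rewrite ltnS; exact: dd.
  move=> m n v; rewrite neq_ltn => /orP[|h]; first exact: lt.
  by rewrite comm// lt.
- move=> v hv; have p0 := hv 0%N.
  rewrite -p0 /=; apply/esym/fp => n; elim: n => [//|n ih].
  by rewrite -{2}ih; apply/esym/subr0_eq; have := hv n.+1.
- by move=> n; exact: sN.
by apply: xn; rewrite -hE.
Qed.

Definition atom_family n (e : 'I_n -> H -> H) :=
  [/\ (forall k, min_central M (e k)), (forall j k v, j != k -> e j (e k v) = 0) &
      forall v, \sum_k e k v = v].

Lemma atomic_family z : atomic z -> exists n (e : nat -> H -> H),
  [/\ (forall k, (k < n)%N -> min_central M (e k)),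
      (forall k, (k < n)%N -> exists v, e k v <> 0),
      (forall j k v, (j < n)%N -> (k < n)%N -> j != k -> e j (e k v) = 0) &
      forall v, \sum_(k < n) e k v = z v].
Proof.
elim=> [|e {}z me ne hz [n [f [mf nf of_ sf]]] ez].
  by exists 0%N, (fun _ _ => 0); split=> // v; rewrite big_ord0.
have cz := atomic_cproj hz.
have le := cproj_linear hM me.1.
have fz k v : (k < n)%N -> z (f k v) = f k v.
  move=> kn; rewrite -sf (bigD1 (Ordinal kn))//= (idem _ (mf _ kn).1).
  rewrite big1 ?addr0// => i ik.
  by apply: of_.
have ef k v : (k < n)%N -> e (f k v) = 0 by move=> kn; rewrite -fz// ez.
exists n.+1, (fun k => if k is j.+1 then f j else e); split.
- by case=> // k; exact: mf.
- by case=> // k; exact: nf.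
- case=> [|j] [|k] v //=.
  + by move=> _ kn _; exact: ef.
  + move=> jn _ _.
    by rewrite -(cproj_commute _ me.1 (cproj_mem (mf _ jn).1)) ef.
  + by move=> ? ? ?; exact: of_.
- by move=> v; rewrite big_ord_recl /=; congr (_ + _); rewrite -sf.
Qed.

Lemma center_finite : central_extension M = op_graph @` M ->
  exists n (e : 'I_n -> H -> H), atom_family e /\ forall k, exists v, e k v <> 0.
Proof.
move=> /identity_atomic/atomic_family[n [e [me ne oe se]]].
exists n, (fun k => e k); split; last by move=> k; exact: ne.
by split=> // [k|j k v jk]; [exact: me|exact: oe].
Qed.

Lemma center_span n (e : 'I_n -> H -> H) T : atom_family e -> vn_center M T ->
  exists c : 'I_n -> R[i], forall v, T v = \sum_k c k *: e k v.
Proof.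
move=> [me oe se] zT.
have /choice[c hc] k : exists c, forall v, T (e k v) = c *: e k v.
  exact: (min_central_scalar hM (me k) zT).
exists c => v; rewrite -{1}(se v) (lin_sum (oa_linear (center_algebra hM) zT)).
by apply: eq_bigr => k _; rewrite hc.
Qed.

End Atoms.

(** * The range of a projection as a Hilbert space *)

Section FixedSpace.
Context {R : realType} {H : hilbertType R} {e : H -> H}.

(** The boundedness of [e] is a parameter of the type because the vector space
    structure uses linearity of [e] and completeness uses its continuity. *)
Definition fixed_space (be : bounded_op e) : Type := {v : H | e v == v}.

Context (be : bounded_op e).
Local Notation K := (fixed_space be).
Let le : linear e := bounded_lin be.

HB.instance Definition _ := Choice.copy K {v : H | e v == v}.

Definition fixed_val (x : K) : H := sval x.

Lemma fixed_valP (x : K) : e (fixed_val x) = fixed_val x.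
Proof. by case: x => v /= /eqP. Qed.

Lemma fixed_val_inj : injective fixed_val.
Proof. by move=> x y; exact: val_inj. Qed.

Definition fixed_mk v (h : e v = v) : K := exist _ v (introT eqP h).

Lemma fixed_zero_subproof : e 0 = 0. Proof. exact: lin0. Qed.
Lemma fixed_opp_subproof (x : K) : e (- fixed_val x) = - fixed_val x.
Proof. by rewrite linN// fixed_valP. Qed.
Lemma fixed_add_subproof (x y : K) :
  e (fixed_val x + fixed_val y) = fixed_val x + fixed_val y.
Proof. by rewrite linD// !fixed_valP. Qed.
Lemma fixed_scale_subproof (a : R[i]) (x : K) : e (a *: fixed_val x) = a *: fixed_val x.
Proof. by rewrite linZ// fixed_valP. Qed.

Definition fixed_zero : K := fixed_mk fixed_zero_subproof.
Definition fixed_opp x : K := fixed_mk (fixed_opp_subproof x).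
Definition fixed_add x y : K := fixed_mk (fixed_add_subproof x y).
Definition fixed_scale a x : K := fixed_mk (fixed_scale_subproof a x).

Lemma fixed_addA : associative fixed_add.
Proof. by move=> x y z; apply: fixed_val_inj; rewrite /= addrA. Qed.
Lemma fixed_addC : commutative fixed_add.
Proof. by move=> x y; apply: fixed_val_inj; rewrite /= addrC. Qed.
Lemma fixed_add0 : left_id fixed_zero fixed_add.
Proof. by move=> x; apply: fixed_val_inj; rewrite /= add0r. Qed.
Lemma fixed_addN : left_inverse fixed_zero fixed_opp fixed_add.
Proof. by move=> x; apply: fixed_val_inj; rewrite /= addNr. Qed.

HB.instance Definition _ := GRing.isZmodule.Build K
  fixed_addA fixed_addC fixed_add0 fixed_addN.

Lemma fixed_scaleA a b (x : K) :
  fixed_scale a (fixed_scale b x) = fixed_scale (a * b) x.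
Proof. by apply: fixed_val_inj; rewrite /= scalerA. Qed.
Lemma fixed_scale1 : left_id 1 fixed_scale.
Proof. by move=> x; apply: fixed_val_inj; rewrite /= scale1r. Qed.
Lemma fixed_scaleDr : right_distributive fixed_scale +%R.
Proof. by move=> a x y; apply: fixed_val_inj; rewrite /= scalerDr. Qed.
Lemma fixed_scaleDl x : {morph fixed_scale^~ x : a b / a + b}.
Proof. by move=> a b; apply: fixed_val_inj; rewrite /= scalerDl. Qed.

HB.instance Definition _ := GRing.Zmodule_isLmodule.Build R[i] K
  fixed_scaleA fixed_scale1 fixed_scaleDr fixed_scaleDl.

Lemma fixed_val_linear : linear fixed_val.
Proof. by []. Qed.

Lemma fixed_normD (x y : K) : `|fixed_val (x + y)| <= `|fixed_val x| + `|fixed_val y|.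
Proof. exact: ler_normD. Qed.
Lemma fixed_normZ (l : R[i]) (x : K) : `|fixed_val (l *: x)| = `|l| * `|fixed_val x|.
Proof. exact: normrZ. Qed.
Lemma fixed_norm0 (x : K) : `|fixed_val x| = 0 -> x = 0.
Proof. by move=> /eqP; rewrite normr_eq0 => /eqP h; apply: fixed_val_inj. Qed.

HB.instance Definition _ := @Lmodule_isNormed.Build R[i] K
  (fun x => `|fixed_val x|) fixed_normD fixed_normZ fixed_norm0.

Lemma fixed_complete (F : set_system K) : ProperFilter F -> cauchy F -> cvg F.
Proof.
move=> FF /cauchy_ballP cF.
have ballE (x y : K) r : ball x r y <-> ball (fixed_val x) r (fixed_val y).
  by rewrite -!ball_normE.
have /cauchy_cvgP/cvg_ex[l hl] : cauchy (fixed_val @ F).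
  apply/cauchy_ballP => r r0; have [[A B] /= [FA FB] hAB] := cF r r0.
  exists (fixed_val @` A, fixed_val @` B).
    by split; [apply: filterS FA|apply: filterS FB] => x ?; exists x.
  move=> [_ _] /= [[x Ax <-] [y By <-]]; apply/ballE; exact: (hAB (x, y)).
have el : e l = l.
  apply/subr0_eq/hnorm_eq0/eqP.
  have /bounded_opP[_ [k k0 hk]] := be.
  rewrite eq_le hnorm_ge0 andbT; apply/ler_addgt0Pr => d d0; rewrite add0r.
  have /fcvgrPdist_lt/(_ (d / (k + 1))%:C) := hl.
  rewrite ltcR divr_gt0 ?addr_gt0// => /(_ isT) hF.
  have [x /=] := @filter_ex _ F _ _ hF.
  rewrite hnormE ltcR ltr_pdivlMr ?addr_gt0// => hx.
  have -> : e l - l = e (l - fixed_val x) - (l - fixed_val x).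
    by rewrite (linB le) fixed_valP; vec.
  have := hnorm_triangle (e (l - fixed_val x)) (- (l - fixed_val x)); rewrite hnorm_opp.
  have := hk (l - fixed_val x).
  by move: hx; move: (hnorm _) (hnorm _) (hnorm _) => *; nra.
apply/cvg_ex; exists (fixed_mk el); apply/fcvgrPdist_lt => r r0.
by move/fcvgrPdist_lt : hl => /(_ r r0).
Qed.

HB.instance Definition _ := Uniform_isComplete.Build K fixed_complete.

Definition fixed_inner (x y : K) : R[i] := inner H (fixed_val x) (fixed_val y).

Lemma fixed_inner_bilinear : bilinear_for
  (GRing.Scale.Law.clone _ _ *%R _)
  (GRing.Scale.Law.clone _ _ (Num.conj \; *%R) _) fixed_inner.
Proof.
split=> x a u v; rewrite /fixed_inner.
  by rewrite (fixed_val_linear a u v) ipDl ipZl.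
by rewrite (fixed_val_linear a u v) ipDr ipZr.
Qed.

HB.instance Definition _ := bilinear_isBilinear.Build R[i] K K R[i] _ _
  fixed_inner fixed_inner_bilinear.

Lemma fixed_inner_herm (x y : K) :
  fixed_inner x y = (-1) ^+ false * Num.conj (fixed_inner y x).
Proof. by rewrite expr0 mul1r; exact: ipC. Qed.

HB.instance Definition _ := isHermitianSesquilinear.Build R[i] K false Num.conj
  fixed_inner fixed_inner_herm.

Lemma fixed_inner_gt0 (x : K) : x != 0 -> 0 < fixed_inner x x.
Proof.
move=> x0; rewrite lt_def ip_ge0 andbT; apply: contra x0 => /eqP/ip_eq0 h.
by apply/eqP/fixed_val_inj.
Qed.

HB.instance Definition _ := isDotProduct.Build R[i] K fixed_inner fixed_inner_gt0.

Lemma fixed_inner_norm (x : K) :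
  (fixed_inner : {dot K for @Num.conj R[i]}) x x = `|x| ^+ 2.
Proof. exact: inner_norm. Qed.

Definition fixed_hilbert : hilbertType R := @Hilbert R K _ fixed_inner_norm.

End FixedSpace.

(** * Corners of a von Neumann algebra *)

Section Corner.
Context {R : realType} {H : hilbertType R} {M : set (H -> H)}.
Hypothesis hM : von_neumann M.
Context {e : H -> H}.
Hypothesis ce : central_proj M e.
Implicit Types (u v w : H) (T S W : H -> H).

Local Notation ip := (inner H).

Let be : bounded_op e := oa_bounded (vn_algebra hM) (cproj_mem ce).

Definition corner_space : hilbertType R := fixed_hilbert be.
Local Notation K := corner_space.

Definition corner_val (x : K) : H := fixed_val x.

Definition corner_pr (v : H) : K := fixed_mk be (cproj_idem v ce).

Lemma corner_prK (x : K) : corner_pr (corner_val x) = x.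
Proof. by apply: fixed_val_inj; exact: (fixed_valP x). Qed.

Lemma corner_valK v : corner_val (corner_pr v) = e v.
Proof. by []. Qed.

Lemma corner_valP (x : K) : e (corner_val x) = corner_val x.
Proof. exact: fixed_valP. Qed.

Lemma corner_val_inj : injective corner_val.
Proof. exact: fixed_val_inj. Qed.

Lemma corner_val_linear : linear corner_val.
Proof. by []. Qed.

Lemma corner_pr_linear : linear corner_pr.
Proof.
move=> c u v; apply: corner_val_inj.
by rewrite corner_val_linear !corner_valK (cproj_linear hM ce).
Qed.

Lemma corner_hnorm (x : K) : hnorm x = hnorm (corner_val x).
Proof. by []. Qed.

Lemma corner_inner (x y : K) : inner K x y = ip (corner_val x) (corner_val y).
Proof. by []. Qed.

(** Cutting down to the corner and extending by zero are inverse to each other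
    on operators living on the range of [e]. *)
Definition compress T : K -> K := fun x => corner_pr (T (corner_val x)).

Definition extend (t : K -> K) : H -> H := fun v => corner_val (t (corner_pr v)).

Lemma compress_bounded T : bounded_op T -> bounded_op (compress T).
Proof.
move=> /bounded_opP[lT [k k0 hk]].
have /bounded_opP[_ [l l0 hl]] := be.
apply/bounded_opP; split.
  by move=> c x y; rewrite /compress corner_val_linear lT corner_pr_linear.
exists (l * k) => [|x]; first exact: mulr_gt0.
rewrite !corner_hnorm corner_valK -mulrA; apply: le_trans (hl _) _.
by rewrite ler_wpM2l// ltW.
Qed.

Lemma extend_bounded t : bounded_op t -> bounded_op (extend t).
Proof.
move=> /bounded_opP[lt [k k0 hk]].
have /bounded_opP[_ [l l0 hl]] := be.
apply/bounded_opP; split.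
  by move=> c x y; rewrite /extend corner_pr_linear lt corner_val_linear.
exists (k * l) => [|v]; first exact: mulr_gt0.
rewrite -corner_hnorm -mulrA; apply: le_trans (hk _) _.
by rewrite ler_wpM2l ?(ltW k0)// corner_hnorm corner_valK.
Qed.

Lemma compressE T x : (forall v, e (T v) = T (e v)) ->
  corner_val (compress T x) = T (corner_val x).
Proof. by move=> h; rewrite corner_valK h corner_valP. Qed.

Lemma compress_pr T v : (forall v, e (T v) = T (e v)) ->
  compress T (corner_pr v) = corner_pr (T v).
Proof.
by move=> h; apply: corner_val_inj; rewrite (compressE _ h) !corner_valK h.
Qed.

Let commM T v : M T -> e (T v) = T (e v).
Proof. by move=> MT; exact: (cproj_commute _ ce MT). Qed.

Let commM' T v : commutant M T -> e (T v) = T (e v).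
Proof. by move=> /commutantP[_ h]; rewrite h//; exact: cproj_mem. Qed.

Definition corner : set (K -> K) := compress @` M.

Lemma corner_bounded : corner `<=` bounded_op.
Proof. by move=> _ [T MT <-]; apply/compress_bounded/(oa_bounded (vn_algebra hM)). Qed.

Lemma extend_compress T : M T -> extend (compress T) = fun v => T (e v).
Proof.
by move=> MT; apply/funext => v; rewrite /extend compressE// => w; exact: commM.
Qed.

Lemma extendK t : compress (extend t) = t.
Proof.
apply/funext => x; apply: corner_val_inj.
by rewrite /compress /extend !corner_prK.
Qed.

Lemma corner_extend t : corner t -> M (extend t).
Proof.
move=> [T MT <-]; rewrite extend_compress//.
by apply: (oa_comp (vn_algebra hM)) => //; exact: cproj_mem.
Qed.

Lemma extend_commute t S v : (forall v, e (S v) = S (e v)) ->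
  (forall x, t (compress S x) = compress S (t x)) ->
  extend t (S v) = S (extend t v).
Proof.
by move=> eS h; rewrite /extend -(compress_pr _ eS) h (compressE _ eS).
Qed.

(** The commutant of [M] compresses into the commutant of the corner, since its
    elements commute with [e]. Hence the extension of an operator of the bicommutant
    of the corner lies in the bicommutant of [M], that is, in [M]. *)
Lemma corner_von_neumann : von_neumann corner.
Proof.
have [_ adjM _] := hM.
split; first exact: corner_bounded.
  move=> _ [T MT <-]; have [S MS aTS] := adjM T MT.
  exists (compress S); first by exists S.
  move=> x y; rewrite !corner_inner !compressE; try by move=> v; exact: commM.
  exact: aTS.
apply/seteqP; split=> t.
  move=> /commutantP[bt ct].
  exists (extend t); last exact: extendK.
  apply/(vn_memP hM); split; first exact: extend_bounded.
  move=> S cS v; apply: extend_commute => [w|x]; first exact: commM'.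
  apply: ct; apply/commutantP; split.
    by apply: compress_bounded; case: cS.
  move=> _ [T MT <-] y; apply: corner_val_inj.
  rewrite !compressE; try (by move=> w; exact: commM); try (by move=> w; exact: commM').
  by have /commutantP[_ ->] := cS.
move=> ct; apply/commutantP; split; first exact: corner_bounded.
by move=> s /commutantP[_ cs] x; rewrite cs.
Qed.

(** A central element of the corner extends to a central element of [M]. *)
Lemma corner_factor : min_central M e -> vn_factor corner.
Proof.
move=> me; split; first exact: corner_von_neumann.
apply/seteqP; split=> t.
  move=> [ct /commutantP[_ comt]].
  have zT : vn_center M (extend t).
    split; first exact: corner_extend.
    apply/commutantP; split; first exact/extend_bounded/corner_bounded.
    move=> S MS v; apply: extend_commute => [w|x]; first exact: commM.
    by apply: comt; exists S.
  have [c hc] := min_central_scalar hM me zT.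
  exists c => //; apply/funext => x; apply: corner_val_inj.
  rewrite (linZ corner_val_linear) -(corner_valP x) -hc corner_valP.
  by rewrite /extend corner_prK.
move=> [c _ <-]; split.
  exists (fun v => c *: v).
    by apply: (oa_scale (vn_algebra hM)); exact: (oa_id (vn_algebra hM)).
  apply/funext => x; rewrite /compress (linZ corner_pr_linear).
  by rewrite corner_prK.
apply/commutantP; split.
  exact: (bounded_scale c bounded_id).
by move=> s /corner_bounded/bounded_lin ls x; rewrite (linZ ls).
Qed.

End Corner.

Section DirectSum.
Context {R : realType} {H : hilbertType R} {M : set (H -> H)}.
Hypothesis hM : von_neumann M.

(** The summands are the ranges of the atoms; a block diagonal operator with
    blocks in the corners is a finite sum of elements of [M]. *)
Lemma atoms_direct_sum n (e : 'I_n -> H -> H) : (0 < n)%N -> atom_family (M := M) e ->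
  finite_sum_of_factors M.
Proof.
move=> n0 [me oe se].
have ce k : central_proj M (e k) by case: (me k).
exists n, (fun k => corner_space hM (ce k)).
exists (fun k => @corner R H M hM (e k) (ce k)); split=> //.
  by move=> k; exact: corner_factor.
exists (fun k => @corner_val _ _ _ hM _ (ce k)); split=> //.
- move=> j k u v /eqP jk; rewrite -(corner_valP u) -(corner_valP v).
  by rewrite (cproj_sym (ce j)) oe// ip0r.
- move=> xi; exists (fun k => corner_pr hM (ce k) xi).
  by rewrite -{1}(se xi).
apply/seteqP; split=> T.
  move=> MT; split; first exact: (oa_bounded (vn_algebra hM)).
  exists (fun k => compress T); split; first by move=> k; exists T.
  move=> k u; rewrite compressE// => v; exact: (cproj_commute _ (ce k) MT).
move=> [bT [t [Nt Tt]]].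
have /choice[S hS] k : exists S, M S /\ forall v, T (e k v) = S (e k v).
  have [S MS St] := Nt k; exists S; split=> // v.
  rewrite -(corner_valK hM (ce k)) Tt -St compressE// => w.
  exact: (cproj_commute _ (ce k) MS).
rewrite (_ : T = fun v => \sum_k S k (e k v)).
  apply: (oa_sum (vn_algebra hM)) => k _; apply: (oa_comp (vn_algebra hM)).
    by case: (hS k).
  exact: cproj_mem.
apply/funext => v; rewrite -{1}(se v) (lin_sum (bounded_lin bT)).
by apply: eq_bigr => k _; case: (hS k) => _ ->.
Qed.

Lemma finite_sum_of_factors_of_eq : central_extension M = op_graph @` M ->
  finite_sum_of_factors M.
Proof.
move=> hE; have [[|n] [e [ae ne]]] := center_finite hM hE; last first.
  exact: (atoms_direct_sum (e := e)).
have [_ _ se] := ae.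
have z (v : H) : v = 0 by rewrite -(se v) big_ord0.
(* There is no atom only if the space is zero, and then [M] is one factor. *)
apply: (@atoms_direct_sum 1 (fun _ => id)) => //; split.
- move=> _; split; first exact: cproj_id.
  by move=> p _; left=> v; rewrite (z (p v)).
- by move=> j k v; rewrite !ord1.
- by move=> v; rewrite big_ord1.
Qed.

End DirectSum.

(** * Finite direct sums of factors *)

Section AtomsExtension.
Context {R : realType} {H : hilbertType R} {M : set (H -> H)}.
Hypothesis hM : von_neumann M.
Context {n : nat} {e : 'I_n -> H -> H}.
Hypothesis ae : atom_family (M := M) e.

Local Notation ip := (inner H).

(** Each summand is seen by a single member of a central partition of unity,
    so finitely many members decide the operator. *)
Lemma central_extension_atoms : central_extension M = op_graph @` M.
Proof.
have [me oe se] := ae.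
have ce k : central_proj M (e k) by case: (me k).
have le k := cproj_linear hM (ce k).
apply/seteqP; split; last by move=> _ [T MT <-]; exact: graph_central_extension.
move=> x [[[linx clx] _ _] [I [z [cz oz sz xz]]]].
have commz k i v : e k (z i v) = z i (e k v).
  exact: (cproj_commute _ (ce k) (cproj_mem (cz i))).
(* [J] collects the atoms that lie below some [z i]; their sum [q] dominates all
   the [z i], hence is 1. *)
pose J k := `[< exists i, forall v, z i (e k v) = e k v >].
pose q v := \sum_(k | J k) e k v.
have ek k v : q (e k v) = if J k then e k v else 0.
  rewrite /q; case: ifPn => Jk.
    rewrite (bigD1 k)//= (cproj_idem v (ce k)) big1 ?addr0// => j /andP[_ jk].
    exact: oe.
  rewrite big1// => j Jj; apply: oe; apply: contra Jk => /eqP <-//.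
have Mq : M q by apply: (oa_sum (vn_algebra hM)) => k _; exact: cproj_mem.
have lq := oa_linear (vn_algebra hM) Mq.
have qid : q = id.
  apply: sz.
    split=> //.
      apply/funext => v /=; rewrite {2}/q (lin_sum lq) /q.
      by apply: eq_bigr => k Jk; rewrite -/(q (e k v)) ek Jk.
    move=> u v; rewrite /q ip_suml ip_sumr; apply: eq_bigr => k _.
    exact: cproj_sym.
  move=> i _ [v _ <-]; exists (z i v) => //.
  rewrite -[RHS]se [RHS](bigID J) /= [X in _ = _ + X]big1 ?addr0// => k Jk.
  rewrite commz; have [//|h] := (me k).2 (z i) (cz i).
  by case/negP: Jk; apply/asboolP; exists i.
have /choice[T hT] i : exists T, M T /\ op_graph T = strong_prod (op_graph (z i)) x.
  by have [T MT Tx] := xz i; exists T.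
have zxT i xi eta : x (xi, eta) -> z i eta = T i xi.
  move=> h; have : strong_prod (op_graph (z i)) x (xi, z i eta).
    by apply: subset_closure; exists eta.
  by case: (hT i) => _ <-.
have /choice[S hS] k : exists S, M S /\ (J k -> exists i,
    (forall v, z i (e k v) = e k v) /\ S = T i).
  case Jk: (J k); last first.
    by exists (fun _ => 0); split=> //; exact: (oa_0 (vn_algebra hM)).
  have /asboolP[i hi] := Jk; exists (T i); split; first by case: (hT i).
  by move=> _; exists i.
pose A v := \sum_(k | J k) e k (S k v).
have MA : M A.
  apply: (oa_sum (vn_algebra hM)) => k _; apply: (oa_comp (vn_algebra hM)).
    exact: cproj_mem.
  by case: (hS k).
have bA := oa_bounded (vn_algebra hM) MA.
have xA : x `<=` op_graph A.
  move=> [xi eta] h; rewrite /op_graph /=.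
  rewrite -[LHS](_ : q eta = eta); last by rewrite qid.
  apply: eq_bigr => k Jk; have [i [hi ->]] := (hS k).2 Jk.
  by rewrite -(zxT i _ _ h) commz hi.
exists A => //; apply/seteqP; split=> // -[xi eta].
rewrite {1}/op_graph /= => ->.
(* Some [z i x] being everywhere defined makes the domain of [x] dense; without
   any index the space is zero. *)
have [[i _]|nI] := pselect (exists i : I, True); last first.
  have z0 : (fun _ : H => 0 : H) = id.
    apply: sz => [|i]; last by case: nI; exists i.
    split=> //; first exact: oa_0 (vn_algebra hM).
    by move=> u v; rewrite ip0l ip0r.
  have -> : A xi = 0 by have /(congr1 (@^~ (A xi))) := z0.
  have -> : xi = 0 by have /(congr1 (@^~ xi)) := z0.
  by case: linx.
apply: clx; apply/closure_graphP => d d0 /=.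
have /bounded_opP[lA [k k0 hk]] := bA.
have : closure (prod_op (op_graph (z i)) x) (xi, T i xi).
  by case: (hT i) => _ h; rewrite -/(strong_prod _ _) -h.
move=> /closure_graphP /(_ (Num.min d (d / k))).
rewrite lt_min d0 divr_gt0// => /(_ isT) [[u w] /= [eta' xu _]] [+ _].
rewrite lt_min => /andP[h1 h2]; exists (u, eta') => //=; split=> //.
have -> : eta' = A u by exact: (xA _ xu).
rewrite -(linB lA); apply: le_lt_trans (hk _) _.
by rewrite mulrC -ltr_pdivlMr.
Qed.

End AtomsExtension.

Section DirectSumAtoms.
Context {R : realType} {H : hilbertType R} {M : set (H -> H)}.
Hypothesis hM : von_neumann M.
Context {n : nat} {K : 'I_n -> hilbertType R} {N : forall k, set (K k -> K k)}.
Hypothesis fN : forall k, vn_factor (@N k).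
Context {V : forall k, K k -> H}.
Hypotheses (lV : forall k, linear (@V k))
  (iV : forall k u v, inner H (@V k u) (@V k v) = inner (K k) u v)
  (oV : forall j k u v, j <> k -> inner H (@V j u) (@V k v) = 0)
  (sV : forall xi : H, exists u : forall k, K k, xi = \sum_k V (u k))
  (MV : M = [set T | bounded_op T /\ exists t : forall k, K k -> K k,
                 (forall k, N (t k)) /\ forall k u, T (V u) = @V k (t k u)]).

Local Notation ip := (inner H).

Lemma summand_injective k : injective (@V k).
Proof. by move=> u v h; apply: ip_inj => w; rewrite -!iV h. Qed.

Lemma summand_coordinates : exists pr : forall k, H -> K k,
  (forall xi, \sum_k V (pr k xi) = xi) /\
  forall k xi w, inner (K k) (pr k xi) w = ip xi (V w).
Proof.
have /choice[f hf] := sV; exists (fun k xi => f xi k); split=> // k xi w.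
rewrite [X in ip X _]hf ip_suml (bigD1 k)//= iV big1 ?addr0// => j /eqP jk.
exact: oV.
Qed.

Section Coordinates.
Context {pr : forall k, H -> K k}.
Hypotheses (prS : forall xi, \sum_k V (pr k xi) = xi)
  (prP : forall k xi w, inner (K k) (pr k xi) w = ip xi (V w)).

Lemma coord_linear k : linear (@pr k).
Proof. by move=> c u v; apply: ip_inj => w; rewrite ipDl ipZl !prP ipDl ipZl. Qed.

Lemma summand_hnorm k u : hnorm (@V k u) = hnorm u.
Proof.
have : hnorm (V u) ^+ 2 = hnorm u ^+ 2 by rewrite !hnorm_sqr iV.
by move=> /eqP; rewrite eqrXn2// ?hnorm_ge0// => /eqP.
Qed.

Lemma coord_hnorm k xi : hnorm (pr k xi) <= hnorm xi.
Proof.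
have [->|h] := eqVneq (hnorm (pr k xi)) 0; first exact: hnorm_ge0.
have p0 : 0 < hnorm (pr k xi) by rewrite lt_def h hnorm_ge0.
rewrite -(ler_pM2r p0) -expr2 -lecR -ip_hnorm.
have := ip_CS xi (V (pr k xi)); rewrite -prP summand_hnorm.
by rewrite ger0_norm ?ip_ge0.
Qed.

Lemma coord_summand k u : pr k (V u) = u.
Proof. by apply: ip_inj => w; rewrite prP iV. Qed.

Lemma coord_summand_neq j k u : j <> k -> pr j (@V k u) = 0.
Proof. by move=> jk; apply: ip_inj => w; rewrite prP ip0l oV// => kj; exact: jk. Qed.

Definition block k (s : K k -> K k) : H -> H := fun xi => V (s (pr k xi)).

Lemma block_bounded k (s : K k -> K k) : bounded_op s -> bounded_op (block s).
Proof.
move=> /bounded_opP[ls [l l0 hl]]; apply/bounded_opP; split.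
  by move=> c u v; rewrite /block coord_linear ls lV.
exists l => // v; rewrite summand_hnorm; apply: le_trans (hl _) _.
by rewrite ler_wpM2l ?(ltW l0)// coord_hnorm.
Qed.

Lemma block_mem k (s : K k -> K k) : N s -> M (block s).
Proof.
move=> Ns; have [vN _] := fN k.
rewrite MV; split; first exact/block_bounded/(oa_bounded (vn_algebra vN)).
exists (fun j x => pr j (block s (V x))); split => j.
  have [->|/eqP jk] := eqVneq j k.
    rewrite (_ : (fun _ => _) = s)//; apply/funext => x.
    by rewrite /block !coord_summand.
  rewrite (_ : (fun _ => _) = fun _ => 0).
    by apply: oa_0; case: (fN j) => h _; exact: vn_algebra.
  apply/funext => x; rewrite /block coord_summand_neq//.
move=> x; have [jk|/eqP jk] := eqVneq j k.
  by subst j; rewrite /block !coord_summand.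
rewrite /block (coord_summand_neq (j := k)); last by move=> kj; exact: jk.
rewrite (lin0 (oa_linear (vn_algebra vN) Ns)) (lin0 (@lV k)).
by rewrite (lin0 (@coord_linear j)) (lin0 (@lV j)).
Qed.

(** The restriction of a central projection to a summand is central in the
    corresponding factor, hence a scalar [c] with [c ^ 2 = c]. *)
Lemma blocks_atoms : atom_family (M := M) (fun k => block (@id (K k))).
Proof.
have oe j k v : j != k -> block (@id (K j)) (block (@id (K k)) v) = 0.
  by move=> /eqP jk; rewrite /block coord_summand_neq// (lin0 (@lV j)).
have se v : \sum_k block (@id (K k)) v = v by exact: prS.
have Me k : M (block (@id (K k))).
  by apply: block_mem; case: (fN k) => vN _; exact: (oa_id (vn_algebra vN)).
have commute k T v : M T -> block (@id (K k)) (T v) = T (block (@id (K k)) v).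
  rewrite {1}MV => -[bT [t [Nt Tt]]].
  rewrite -{1}(se v) (lin_sum (bounded_lin bT)) /block.
  rewrite (lin_sum (@coord_linear k)) (lin_sum (@lV k)) (bigD1 k)//= Tt coord_summand.
  rewrite big1 ?addr0// => j /eqP jk.
  by rewrite Tt coord_summand_neq ?(lin0 (@lV k))// => kj; exact: jk.
have ce k : central_proj M (block (@id (K k))).
  apply/(cprojP); split.
  - split=> //; apply/commutantP; split; first exact: (oa_bounded (vn_algebra hM)).
    by move=> T MT v; exact: commute.
  - by move=> v; rewrite /block coord_summand.
  - by move=> u v; rewrite /block ipC -prP -ipC -prP ipC.
split=> // k; split=> // z cz.
have lz := cproj_linear hM cz.
have [bz [t [Nt zt]]] : [set T | bounded_op T /\ exists t : forall k, K k -> K k,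
    (forall k, N (t k)) /\ forall k u, T (V u) = @V k (t k u)] z.
  by rewrite -MV; exact: cproj_mem.
have [vN cN] := fN k.
have : vn_center (@N k) (t k).
  split=> //; apply/commutantP; split; first exact: (oa_bounded (vn_algebra vN)).
  move=> s Ns x; apply: summand_injective; rewrite -zt.
  have := cproj_commute (V x) cz (block_mem Ns).
  by rewrite zt /block !coord_summand.
rewrite cN => -[c _ tc].
have zc v : z (block (@id (K k)) v) = c *: block (@id (K k)) v.
  by rewrite /block zt -tc (linZ (@lV k)).
have [c1|c1] := eqVneq c 1; first by right=> v; rewrite zc c1 scale1r.
left=> v; have := cproj_idem (block (@id (K k)) v) cz.
rewrite zc (linZ lz) zc scalerA => /eqP; rewrite -subr_eq0 -scalerBl scaler_eq0.
rewrite (_ : c * c - c = c * (c - 1)); last by ring.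
rewrite mulf_eq0 subr_eq0 (negPf c1) orbF => /orP[/eqP ->|/eqP ->].
  by rewrite scale0r.
by rewrite scaler0.
Qed.

End Coordinates.
End DirectSumAtoms.

Section Equivalence.
Context {R : realType} {H : hilbertType R} {M : set (H -> H)}.
Hypothesis hM : von_neumann M.

Lemma eq_of_finite_sum_of_factors : finite_sum_of_factors M ->
  central_extension M = op_graph @` M.
Proof.
move=> [n [K [N [_ fN [V [lV iV oV sV MV]]]]]].
have [pr [prS prP]] := summand_coordinates iV oV sV.
exact: (central_extension_atoms hM (blocks_atoms hM fN lV iV oV MV prS prP)).
Qed.

End Equivalence.

(** * Operator norm and absolute value *)

Section OperatorNorm.
Context {R : realType} {H : hilbertType R}.
Implicit Types (u v w : H) (T S Y : H -> H).

Local Notation ip := (inner H).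

Lemma opnorm_ub T v : bounded_op T -> hnorm v <= 1 -> hnorm (T v) <= opnorm T.
Proof.
move=> /bounded_opP[lT [k k0 hk]] v1; apply: ub_le_sup; last by exists v.
exists k => _ [w w1 <-]; apply: le_trans (hk w) _.
by rewrite -[leRHS]mulr1 ler_wpM2l// ltW.
Qed.

Lemma opnorm_ge0 T : bounded_op T -> 0 <= opnorm T.
Proof.
move=> bT; have := @opnorm_ub T 0 bT; rewrite hnorm0 => /(_ ler01).
exact: le_trans (hnorm_ge0 _).
Qed.

Lemma opnorm_bound T v : bounded_op T -> hnorm (T v) <= opnorm T * hnorm v.
Proof.
move=> bT; have lT := bounded_lin bT.
have [->|h] := eqVneq v 0; first by rewrite (lin0 lT) hnorm0 mulr0.
have v0 : 0 < hnorm v.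
  by rewrite lt_def hnorm_ge0 andbT; apply: contra h => /eqP/hnorm_eq0 ->.
have := @opnorm_ub T ((hnorm v)^-1%:C *: v) bT.
rewrite (linZ lT) !hnormZr ger0_norm ?invr_ge0 ?(ltW v0)// mulVf ?gt_eqF//.
by move=> /(_ (lexx _)); rewrite mulrC ler_pdivrMr.
Qed.

Lemma opnorm_le T (k : R) : 0 <= k -> (forall v, hnorm (T v) <= k * hnorm v) ->
  opnorm T <= k.
Proof.
move=> k0 hk; apply: ge_sup.
  by exists (hnorm (T 0)); exists 0 => //=; rewrite hnorm0.
move=> _ [v v1 <-]; apply: le_trans (hk v) _.
by rewrite -[leRHS]mulr1 ler_wpM2l.
Qed.

End OperatorNorm.

Section AbsoluteValue.
Context {R : realType} {H : hilbertType R}.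
Implicit Types (u v w : H) (T S Y W : H -> H).

Local Notation ip := (inner H).

(** Any [a] with [a a = Y* Y] is everywhere defined, hence bounded because
    [|a v| = |Y v|], and is therefore the square root constructed above. *)
Lemma is_absP Y Y' : bounded_op Y -> adjoint_pair Y Y' ->
  exists S, [/\ bounded_op S, adjoint_pair S S, (forall v, 0 <= ip (S v) v),
    (forall v, hnorm (S v) = hnorm (Y v)) /\
    (forall W, bounded_op W -> (forall v, W (Y' (Y v)) = Y' (Y (W v))) ->
      forall v, W (S v) = S (W v)) &
    forall a, is_abs (op_graph Y) a <-> a = op_graph S].
Proof.
move=> bY aY; have bY' := adjoint_bounded bY aY.
have [|||S [bS sS pS SS cS]] := @positive_sqrt _ _ (fun v => Y' (Y v)).
- exact: bounded_comp.
- by move=> u v; rewrite (adjoint_sym aY) aY.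
- by move=> v; rewrite (adjoint_sym aY) ip_ge0.
have norm_root T v : adjoint_pair T T -> T (T v) = Y' (Y v) ->
    hnorm (T v) = hnorm (Y v).
  move=> sT TT; have : hnorm (T v) ^+ 2 = hnorm (Y v) ^+ 2.
    by rewrite !hnorm_sqr sT TT aY.
  by move=> /eqP; rewrite eqrXn2// ?hnorm_ge0// => /eqP.
exists S; split=> //; first by split=> // v; exact: norm_root.
move=> a; rewrite /is_abs (adj_op_graph aY) prod_op_graph; split; last first.
  move=> ->; split; first exact: positive_op_graph (bounded_lin bS) sS pS.
  by rewrite prod_op_graph; congr op_graph; apply/funext => v; rewrite SS.
move=> [[[a0 aL a1] adja pa] aa].
have /choice[A hA] v : exists w, a (v, w) /\ a (w, Y' (Y v)).
  have : prod_op a a (v, Y' (Y v)) by rewrite aa.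
  by move=> [w h1 h2]; exists w.
have aE v w : a (v, w) -> w = A v by move=> h; apply: a1 h _; case: (hA v).
have agA : a = op_graph A.
  apply/seteqP; split=> -[v w]; rewrite /op_graph /=; first exact: aE.
  by move=> ->; case: (hA v).
have lA : linear A.
  move=> c u v; apply/esym/aE.
  by have := aL c (u, A u) (v, A v) (hA u).1 (hA v).1.
have sA : adjoint_pair A A.
  move=> u v; have : adj_op a (v, A v) by rewrite adja; case: (hA v).
  by move=> /(_ (u, A u)); apply; case: (hA u).
have pA v : 0 <= ip (A v) v by apply: (pa (v, A v)); case: (hA v).
have AA v : A (A v) = Y' (Y v) by apply/esym/aE; case: (hA v).
have bA : bounded_op A.
  have /bounded_opP[_ [k k0 hk]] := bY; apply/bounded_opP; split=> //.
  by exists k => // v; rewrite norm_root.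
rewrite agA; congr op_graph; apply/funext.
apply: (positive_sqrt_unique lA (bounded_lin bS)) => // v; first by rewrite AA SS.
by apply: cS => // w; rewrite -!AA.
Qed.

End AbsoluteValue.

(** * Central elements in the presence of finitely many atoms *)

Section Diagonal.
Context {R : realType} {H : hilbertType R} {M : set (H -> H)}.
Hypothesis hM : von_neumann M.
Context {n : nat} {e : 'I_n -> H -> H}.
Hypotheses (ae : atom_family (M := M) e) (ne : forall k, exists v, e k v <> 0).
Implicit Types (u v w : H) (T S Y W : H -> H) (c g h : 'I_n -> R[i]).

Local Notation ip := (inner H).

Let ce k : central_proj M (e k).
Proof. by have [me _ _] := ae; case: (me k). Qed.
Let le k : linear (e k).
Proof. exact: (cproj_linear hM (ce k)). Qed.
Let se k : adjoint_pair (e k) (e k).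
Proof. exact: (cproj_sym (ce k)). Qed.
Let ee k v : e k (e k v) = e k v.
Proof. exact: (cproj_idem v (ce k)). Qed.
Let oe j k v : j != k -> e j (e k v) = 0.
Proof. by have [_ h _] := ae; exact: h. Qed.
Let sume v : \sum_k e k v = v.
Proof. by have [_ _ h] := ae. Qed.

Definition diag_op c : H -> H := fun v => \sum_k c k *: e k v.

Lemma diagonal_center c : vn_center M (diag_op c).
Proof.
apply: (oa_sum (center_algebra hM)) => k _; apply: (oa_scale (center_algebra hM)).
exact: cproj_center.
Qed.

Lemma diagonal_bounded c : bounded_op (diag_op c).
Proof. exact: (oa_bounded (center_algebra hM) (diagonal_center c)). Qed.

Lemma diagonal_measurable c : measurable_op (vn_center M) (op_graph (diag_op c)).
Proof. exact: (measurable_graph (center_algebra hM) (diagonal_center c)). Qed.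

Lemma center_diagonal T : vn_center M T -> exists c, T = diag_op c.
Proof.
by move=> /(center_span hM ae)[c hc]; exists c; apply/funext.
Qed.

Lemma diagonal_atom c k v : diag_op c (e k v) = c k *: e k v.
Proof.
rewrite /diag_op (bigD1 k)//= ee big1 ?addr0// => j jk.
by rewrite oe// scaler0.
Qed.

Lemma atom_ip j k u v : j != k -> ip (e j u) (e k v) = 0.
Proof. by move=> jk; rewrite se oe// ip0r. Qed.

Lemma ip_atoms u v : ip u v = \sum_k ip (e k u) (e k v).
Proof.
rewrite -{1}(sume u) ip_suml; apply: eq_bigr => k _.
by rewrite !se ee.
Qed.

Lemma hnorm_atoms v : hnorm v ^+ 2 = \sum_k hnorm (e k v) ^+ 2.
Proof.
apply: complexI; rewrite -ip_hnorm ip_atoms.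
rewrite [RHS](raddf_sum (real_complex R)); apply: eq_bigr => k _.
by rewrite ip_hnorm.
Qed.

Lemma diagonal_form c v : ip (diag_op c v) v = \sum_k c k * ip (e k v) (e k v).
Proof.
rewrite /diag_op ip_suml; apply: eq_bigr => k _.
by rewrite ipZl !se ee.
Qed.

Lemma atom_ip_gt0 k : exists v, 0 < ip (e k v) (e k v).
Proof.
have [v hv] := ne k; exists v; rewrite lt_def ip_ge0 andbT.
by apply/eqP => /ip_eq0.
Qed.

Lemma diagonal_sym c : (forall k, c k \is Num.real) ->
  adjoint_pair (diag_op c) (diag_op c).
Proof.
move=> rc u v; rewrite /diag_op ip_suml ip_sumr; apply: eq_bigr => k _.
by rewrite ipZl ipZr se (CrealP (rc k)).
Qed.

Lemma diagonal_positive c :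
  positive_op (op_graph (diag_op c)) <-> forall k, 0 <= c k.
Proof.
split=> [[_ _ pc] k|c0].
  have [v hv] := atom_ip_gt0 k.
  have := pc (e k v, diag_op c (e k v)) erefl => /=.
  by rewrite diagonal_atom ipZl pmulr_lge0.
apply: positive_op_graph; first exact: (bounded_lin (diagonal_bounded c)).
  by apply: diagonal_sym => k; apply: ger0_real.
by move=> v; rewrite diagonal_form sumr_ge0// => k _; rewrite mulr_ge0 ?ip_ge0.
Qed.

Lemma diagonal_le g h : op_le (op_graph (diag_op g)) (op_graph (diag_op h)) <->
  forall k, g k <= h k.
Proof.
rewrite op_le_graph; try exact: diagonal_bounded.
rewrite (_ : (fun _ => _) = diag_op (fun k => h k - g k)); last first.
  apply/funext => v; rewrite /diag_op -sumrB; apply: eq_bigr => k _.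
  by rewrite scalerBl.
rewrite diagonal_positive; split=> hk k; have := hk k; by rewrite subr_ge0.
Qed.

(** Compare the eigenvalues at a fixed [e k v0], at [e k v], and at their sum. *)
Lemma eigen_scalar (X : H -> H) k : linear X ->
  (forall w, e k w = w -> exists l : R[i], X w = l *: w) ->
  exists l : R[i], forall v, X (e k v) = l *: e k v.
Proof.
move=> lX hX; have [v0 hv0] := ne k.
have [l0 h0] := hX _ (ee k v0).
exists l0 => v; have [l hl] := hX _ (ee k v).
have [|m hm] := hX (e k v0 + e k v); first by rewrite (linD (le k)) !ee.
rewrite (linD lX) h0 hl scalerDr in hm.
have [ml|ml] := eqVneq m l0.
  by move: hm; rewrite ml => /addrI <-.
have m0 : m - l0 != 0 by rewrite subr_eq0.
set nu := (m - l0)^-1 * (l - m).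
have v0E : e k v0 = nu *: e k v.
  have h : (m - l0) *: e k v0 = (l - m) *: e k v.
    apply/subr0_eq; rewrite -[RHS](subrr (m *: e k v0 + m *: e k v)) -{2}hm.
    by vec.
  by rewrite /nu -scalerA -h scalerA mulVf// scale1r.
have nu0 : nu != 0.
  by apply: contra_not_neq hv0 => nu0; rewrite v0E nu0 scale0r.
move: h0; rewrite v0E (linZ lX) hl => /(congr1 (fun y : H => nu^-1 *: y)).
by rewrite !scalerA mulVf// mul1r mulrAC mulVf// mul1r.
Qed.

(** The projections witnessing strong density have supremum 1, so each atom is
    eventually dominated by one of them, and the domain is everything. The
    unitaries of the commutant of the centre include the reflections along the
    vectors of the range of an atom, so each such vector is an eigenvector. *)
Lemma central_measurable x : measurable_op (vn_center M) x ->
  exists c, x = op_graph (diag_op c).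
Proof.
move=> [[[x0 xL x1] clx] [_ affx] [_ [p [pp [_ supp] px _]]]].
have cp m : central_proj M (p m).
  by have [zp pi ps] := pp m; split=> //; split=> //; case: zp.
have domk k v : domain x (e k v).
  have [m hm] : exists m, forall v, p m (e k v) = e k v.
    apply: contrapT => hp.
    have pk0 m v' : p m (e k v') = 0.
      have [me _ _] := ae; have [h|h] := (me k).2 _ (cp m); first exact: h.
      by case: hp; exists m.
    have [v' hv'] := ne k; apply: hv'.
    have qid : (fun v => v - e k v) = id.
      have cq : central_proj M (fun v => v - e k v).
        by apply: (cproj_sub hM (cproj_id hM) (ce k)).
      apply: supp; first by have [[_ qi qs] zq] := cq; split.
      move=> m _ [w _ <-]; exists (p m w) => //.
      by rewrite (cproj_commute _ (ce k) (cproj_mem (cp m))) pk0 subr0.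
    have /(congr1 (@^~ (e k v'))) := qid; rewrite ee subrr.
    by [].
  by apply: (px m); exists (e k v).
have dom v : domain x v.
  rewrite -(sume v); elim/big_ind: _ => //; first by exists 0.
  move=> u w [u' hu] [w' hw]; exists (u' + w').
  by have := xL 1 _ _ hu hw; rewrite !scale1r.
have /choice[X hX] := dom.
have xE v w : x (v, w) -> w = X v by move=> h; apply: x1 h _.
have lX : linear X by move=> c u v; apply/esym/xE; exact: (xL c _ _ (hX u) (hX v)).
have eig k w : e k w = w -> exists l : R[i], X w = l *: w.
  move=> ew; have [->|w0] := eqVneq w 0.
    by exists 0; rewrite (lin0 lX) scaler0.
  have d0 : ip w w != 0 by apply: contra w0 => /eqP/ip_eq0 ->.
  have dr : Num.conj (ip w w) = ip w w by rewrite -ipC.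
  (* The reflection along [w]: commuting with it, [X] maps [w] to a multiple of
     [w]. *)
  pose u v := v - (2 * (ip v w / ip w w)) *: w.
  have lu : linear u by move=> c v v'; rewrite /u ipDl ipZl; vec.
  have uu v : u (u v) = v.
    have ipu : ip (u v) w = - ip v w by rewrite /u ipBl ipZl; field.
    rewrite {1}/u ipu /u; vec.
  have su : adjoint_pair u u.
    move=> v v'; rewrite /u ipBl ipBr ipZl ipZr cjM cj_div dr -ipC.
    rewrite (_ : Num.conj 2 = 2); last exact: conjC_nat.
    by ring.
  have uu' : u \o u = id by apply/funext.
  have unu : unitary_op u by exists u.
  have bu : bounded_op u.
    apply/bounded_opP; split=> //; exists 1 => // v; rewrite mul1r.
    have : hnorm (u v) ^+ 2 = hnorm v ^+ 2 by rewrite !hnorm_sqr su uu.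
    by move=> /eqP; rewrite eqrXn2// ?hnorm_ge0// => /eqP ->.
  have cu : commutant (vn_center M) u.
    apply/commutantP; split=> // T /center_diagonal[c ->] v.
    have lc := bounded_lin (diagonal_bounded c).
    have cw : diag_op c w = c k *: w by rewrite -ew diagonal_atom.
    have ipw v' : ip (diag_op c v') w = c k * ip v' w.
      rewrite /diag_op ip_suml (bigD1 k)//= big1 ?addr0.
        by rewrite ipZl se ew.
      by move=> j jk; rewrite ipZl -ew atom_ip// mulr0.
    rewrite /u (linB lc) (linZ lc) cw ipw scalerA; congr (_ - _ *: _).
    by ring.
  have := xE _ _ (affx u cu unu _ _ (hX w)).
  have -> : u w = - w.
    rewrite /u divff// mulr1 (_ : 2 *: w = w + w).
      by rewrite opprD addrA subrr sub0r.
    by rewrite -[2]/(1 + 1) scalerDl scale1r.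
  rewrite (linN lX) /u => h.
  exists (ip (X w) w / ip w w).
  have : (2 : R[i]) *: X w = 2 *: ((ip (X w) w / ip w w) *: w).
    rewrite [RHS]scalerA -[RHS](subrK (X w)) -[X in X + _]opprB h opprK.
    by rewrite -[2]/(1 + 1) scalerDl scale1r.
  move=> /(congr1 (fun y : H => 2^-1 *: y)).
  by rewrite !scalerA mulVf ?pnatr_eq0// scale1r mulKf ?pnatr_eq0//.
have /choice[c hc] k : exists l : R[i], forall v, X (e k v) = l *: e k v.
  by apply: eigen_scalar => // w; exact: eig.
exists c; apply/seteqP; split=> -[v w]; rewrite /op_graph /=.
  move=> /xE ->; rewrite -{1}(sume v) (lin_sum lX).
  by apply: eq_bigr => k _; rewrite hc.
move=> ->; rewrite (_ : diag_op c v = X v); first exact: hX.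
rewrite -{2}(sume v) (lin_sum lX).
by apply: eq_bigr => k _; rewrite hc.
Qed.

Definition atom_norm Y (k : 'I_n) : R := opnorm (fun v => Y (e k v)).

Let bYe Y k : bounded_op Y -> bounded_op (fun v => Y (e k v)).
Proof.
move=> bY; apply: bounded_comp => //.
exact: (oa_bounded (vn_algebra hM) (cproj_mem (ce k))).
Qed.

Lemma atom_norm_bound Y k v : bounded_op Y ->
  hnorm (Y (e k v)) <= atom_norm Y k * hnorm (e k v).
Proof. by move=> bY; have := opnorm_bound (e k v) (bYe k bY); rewrite ee. Qed.

Lemma atom_norm_le Y k (t : R) : 0 <= t ->
  (forall v, hnorm (Y (e k v)) <= t * hnorm (e k v)) -> atom_norm Y k <= t.
Proof.
move=> t0 h; apply: opnorm_le => // v; apply: le_trans (h v) _.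
rewrite ler_wpM2l// -(@ler_pXn2r _ 2)// ?nnegrE ?hnorm_ge0//.
by rewrite (hnorm_atoms v) (bigD1 k)//= lerDl sumr_ge0// => j _; rewrite sqr_ge0.
Qed.

Lemma atom_norm_ge0 Y k : bounded_op Y -> 0 <= atom_norm Y k.
Proof. by move=> bY; apply: opnorm_ge0; exact: bYe. Qed.

Lemma atom_norm_le_opnorm Y k : bounded_op Y -> atom_norm Y k <= opnorm Y.
Proof.
move=> bY; apply: atom_norm_le; first exact: opnorm_ge0.
by move=> v; exact: opnorm_bound.
Qed.

Lemma opnorm_atoms Y (t : R) : M Y -> 0 <= t -> (forall k, atom_norm Y k <= t) ->
  opnorm Y <= t.
Proof.
move=> MY t0 h; have bY := oa_bounded (vn_algebra hM) MY.
apply: opnorm_le => // v.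
rewrite -(@ler_pXn2r _ 2)// ?nnegrE ?mulr_ge0 ?hnorm_ge0//.
rewrite exprMn (hnorm_atoms v) mulr_sumr (hnorm_atoms (Y v)).
apply: ler_sum => k _; rewrite -exprMn ler_pXn2r// ?nnegrE ?mulr_ge0 ?hnorm_ge0//.
rewrite (cproj_commute _ (ce k) MY); apply: le_trans (atom_norm_bound k v bY) _.
by rewrite ler_wpM2r ?hnorm_ge0.
Qed.

(** On the range of [e k], the Cauchy-Schwarz inequality for the form of [S]
    turns [S <= g k] into [|S v| <= g k |v|], and [|S v| = |Y v|]. *)
Lemma abs_le_diagonal Y S g : M Y -> bounded_op S -> adjoint_pair S S ->
  (forall v, 0 <= ip (S v) v) -> (forall v, hnorm (S v) = hnorm (Y v)) ->
  (forall k v, e k (S v) = S (e k v)) ->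
  op_le (op_graph S) (op_graph (diag_op g)) <-> forall k, (atom_norm Y k)%:C <= g k.
Proof.
move=> MY bS sS pS nS eS; have bY := oa_bounded (vn_algebra hM) MY.
have lS := bounded_lin bS.
rewrite (op_le_graph bS (diagonal_bounded g)); split=> [[_ _ pg] k|hg].
  have Sg v : ip (S (e k v)) (e k v) <= g k * ip (e k v) (e k v).
    have := pg (e k v, diag_op g (e k v) - S (e k v)) erefl => /=.
    by rewrite diagonal_atom ipBl ipZl subr_ge0.
  have g0 : 0 <= g k.
    have [v hv] := atom_ip_gt0 k.
    by rewrite -(pmulr_lge0 _ hv); exact: le_trans (pS _) (Sg v).
  have gE : g k = (complex.Re (g k))%:C by rewrite RRe_real// ger0_real.
  have r0 : 0 <= complex.Re (g k) by rewrite -ler0c -gE.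
  rewrite gE lecR; apply: atom_norm_le => // v.
  rewrite -nS; set w := S (e k v).
  have ew : e k w = w by rewrite /w eS ee.
  have [->|w0] := eqVneq (hnorm w) 0; first by rewrite mulr_ge0// hnorm_ge0.
  have wp : 0 < hnorm w by rewrite lt_def w0 hnorm_ge0.
  have := positive_CS (e k v) w lS sS pS; rewrite -/w.
  have h1 := Sg v; have h2 := Sg w; rewrite !ew in h2.
  move=> h3; have := le_trans h3 (ler_pM (pS _) (pS _) h1 h2).
  rewrite gE !ip_hnorm ger0_norm ?ler0c ?sqr_ge0// -!realCM.
  rewrite (_ : (_%:C ^+ 2) = ((hnorm w ^+ 2) ^+ 2)%:C); last by rewrite -rmorphXn.
  rewrite lecR mulrACA -expr2 -!exprMn.
  rewrite ler_pXn2r// ?nnegrE ?sqr_ge0 ?mulr_ge0 ?hnorm_ge0//.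
  by rewrite expr2 mulrA ler_pM2r.
have gr k : g k \is Num.real.
  by apply: ger0_real; apply: le_trans (hg k); rewrite ler0c atom_norm_ge0.
apply: positive_op_graph.
- by move=> c u v; rewrite (bounded_lin (diagonal_bounded g)) lS; vec.
- by move=> u v; rewrite ipBl ipBr sS (diagonal_sym gr).
move=> v; rewrite ipBl subr_ge0 diagonal_form (ip_atoms (S v)).
apply: ler_sum => k _; rewrite eS.
apply: le_trans (real_ler_norm (symmetric_real _ sS)) _.
apply: le_trans (ip_CS _ _) _; rewrite nS.
apply: le_trans (ler_wpM2r (ip_ge0 _) (hg k)).
rewrite ip_hnorm -realCM lecR expr2 mulrA ler_wpM2r ?hnorm_ge0//.
exact: atom_norm_bound.
Qed.

(** The upper bounds of [|Y|] in [S(Z)] are the diagonal operators whose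
    coefficients dominate those on the right, so the latter are the infimum. *)
Lemma central_normP Y f : M Y -> is_central_norm M (op_graph Y) f <->
  f = op_graph (diag_op (fun k => (atom_norm Y k)%:C)).
Proof.
move=> MY; have bY := oa_bounded (vn_algebra hM) MY.
have [_ adjM _] := hM; have [Y' MY' aY] := adjM Y MY.
have [S [bS sS pS [nS cS] absE]] := is_absP bY aY.
have eS k v : e k (S v) = S (e k v).
  apply: cS; first exact: (oa_bounded (vn_algebra hM) (cproj_mem (ce k))).
  move=> w; rewrite (cproj_commute _ (ce k) MY').
  by rewrite (cproj_commute _ (ce k) MY).
have leP g := abs_le_diagonal g MY bS sS pS nS eS.
set r := fun k => (atom_norm Y k)%:C.
split.
  move=> [a [/absE -> mf fle fge]].
  have [c cE] := central_measurable mf; rewrite cE in fle fge *; congr op_graph.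
  congr diag_op; apply/funext => k; apply/eqP; rewrite eq_le; apply/andP; split.
    have := fle _ (diagonal_measurable r); rewrite leP diagonal_le.
    by apply=> j; exact: lexx.
  have := fge _ (diagonal_measurable r); rewrite diagonal_le; apply.
  move=> g /central_measurable[g' ->]; rewrite leP => hg.
  by rewrite diagonal_le.
move=> ->; exists (op_graph S); split.
- exact/absE.
- exact: diagonal_measurable.
- move=> g /central_measurable[g' ->]; rewrite leP => hg.
  by rewrite diagonal_le.
- move=> h _ hh; apply: hh; first exact: diagonal_measurable.
  by rewrite leP => k; exact: lexx.
Qed.

End Diagonal.

(** * Comparison of the topologies *)

Section LinftyNorm.
Context {R : realType} {d : measure_display} {Omega : measurableType d}.
Context (mu : {measure set Omega -> \bar R}).
Implicit Types (f : Omega -> R[i]) (A B : set Omega).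

Lemma Linfty_normP f (t : R) : 0 <= t ->
  (Linfty_norm mu f <= t%:E)%E <-> \forall w \ae mu, `|f w| <= t%:C.
Proof.
move=> t0; have normE w : (`|(complex.Re `|f w|)%:E| <= t%:E)%E = (`|f w| <= t%:C).
  by rewrite lee_fin ger0_norm -?ler0c ?RRe_real ?ger0_real// -lecR RRe_real ?ger0_real.
rewrite /Linfty_norm unlock; case: ifPn => mu0.
  split=> [/ess_supP|h].
    by apply: filterS => w /=; rewrite normE.
  by apply/ess_supP; apply: filterS h => w /=; rewrite normE.
rewrite lee_fin; split=> // _.
have muT0 : mu setT = 0%E.
  by apply/eqP; rewrite eq_le measure_ge0 andbT leNgt.
by exists setT; split=> //.
Qed.

Lemma ae_meets (P : Omega -> Prop) B : (\forall w \ae mu, P w) ->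
  measurable B -> (0 < mu B)%E -> exists2 w, B w & P w.
Proof.
move=> aeP mB B0; apply: contrapT => h.
have : mu.-negligible B.
  apply: negligibleS aeP => w Bw /= Pw; apply: h; exists w => //.
by move=> /negligibleP-/(_ mB) B00; move: B0; rewrite B00 ltxx.
Qed.

Lemma L0_indic f B : measurable B -> L0 f -> L0 (fun w => f w * \1_B w).
Proof.
move=> mB [fr fi]; split.
  rewrite (_ : (fun _ => _) = (fun w => complex.Re (f w)) \* \1_B).
    by apply: measurable_funM => //; exact: measurable_indic.
  apply/funext => w /=; rewrite !indicE; case: (_ \in _); rewrite ?mulr1 ?mulr0//.
rewrite (_ : (fun _ => _) = (fun w => complex.Im (f w)) \* \1_B).
  by apply: measurable_funM => //; exact: measurable_indic.
by apply/funext => w /=; rewrite !indicE; case: (_ \in _); rewrite ?mulr1 ?mulr0.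
Qed.

End LinftyNorm.

Section Topologies.
Context {R : realType} {H : hilbertType R} {M : set (H -> H)}.
Hypothesis hM : von_neumann M.
Context {n : nat} {e : 'I_n -> H -> H}.
Hypotheses (ae : atom_family (M := M) e) (ne : forall k, exists v, e k v <> 0).
Context {d : measure_display} {Omega : measurableType d}.
Context {mu : {measure set Omega -> \bar R}} {Phi : oper H -> Omega -> R[i]}.
Hypotheses (smu : semifinite mu) (hPhi : identification mu M Phi).
Implicit Types (c g : 'I_n -> R[i]).

Local Notation diag := (@diag_op R H n e).

Let ce k : central_proj M (e k).
Proof. by have [me _ _] := ae; case: (me k). Qed.
Let bounded_center T : vn_center M T -> bounded_op T :=
  @oa_bounded _ _ _ (center_algebra hM) T.
Let meas T : vn_center M T -> measurable_op (vn_center M) (op_graph T) :=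
  @measurable_graph _ _ _ T (center_algebra hM).

Let chi k := Phi (op_graph (e k)).

Let Phi_zero : \forall w \ae mu, Phi (op_graph (fun _ => 0)) w = 0.
Proof.
have m0 := meas (oa_0 (center_algebra hM)).
have := ident_scale hPhi 0 m0.
rewrite strong_scale_graph; last exact/bounded_center/(oa_0 (center_algebra hM)).
rewrite (_ : (fun v => 0 *: 0) = fun _ => 0 :> H); last first.
  by apply/funext => v; rewrite scaler0.
by apply: filterS => w /(_ Logic.I) ->; rewrite mul0r.
Qed.

Let Phi_scale (a : R[i]) T : vn_center M T ->
  \forall w \ae mu, Phi (op_graph (fun v => a *: T v)) w = a * Phi (op_graph T) w.
Proof.
move=> zT; have := ident_scale hPhi a (meas zT).
rewrite strong_scale_graph; last exact: bounded_center.
by apply: filterS => w /(_ Logic.I).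
Qed.

Let Phi_add S T : vn_center M S -> vn_center M T -> \forall w \ae mu,
  Phi (op_graph (fun v => S v + T v)) w = Phi (op_graph S) w + Phi (op_graph T) w.
Proof.
move=> zS zT; have := ident_add hPhi (meas zS) (meas zT).
rewrite strong_sum_graph; try exact: bounded_center.
by apply: filterS => w /(_ Logic.I).
Qed.

Let Phi_mul S T : vn_center M S -> vn_center M T -> \forall w \ae mu,
  Phi (op_graph (fun v => S (T v))) w = Phi (op_graph S) w * Phi (op_graph T) w.
Proof.
move=> zS zT; have := ident_mul hPhi (meas zS) (meas zT).
rewrite strong_prod_graph; try exact: bounded_center.
by apply: filterS => w /(_ Logic.I).
Qed.

Let Phi_diagonal c : \forall w \ae mu,
  Phi (op_graph (diag c)) w = \sum_k c k * chi k w.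
Proof.
rewrite /diag_op; elim: (index_enum _) => [|k r ih].
  rewrite (_ : (fun v => _) = fun _ => 0); last by apply/funext => v; rewrite big_nil.
  by apply: filterS Phi_zero => w ->; rewrite big_nil.
have ze : vn_center M (fun v => c k *: e k v).
  by apply: (oa_scale (center_algebra hM)); exact: cproj_center.
have zr : vn_center M (fun v => \sum_(i <- r) c i *: e i v).
  apply: (oa_sum (center_algebra hM)) => i _.
  by apply: (oa_scale (center_algebra hM)); exact: cproj_center.
rewrite (_ : (fun v => _) =
    fun v => c k *: e k v + \sum_(i <- r) c i *: e i v); last first.
  by apply/funext => v; rewrite big_cons.
have sc := Phi_scale (c k) (cproj_center (ce k)).
apply: filterS3 ih (Phi_add ze zr) sc => w h1 -> ->.
by rewrite big_cons h1.
Qed.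

Let Phi_id : \forall w \ae mu, Phi (op_graph id) w = 1.
Proof.
have zid := oa_id (center_algebra hM).
have L1 : L0 (fun _ : Omega => 1 : R[i]) by split; exact: measurable_cst.
have [x mx x1] := ident_surj hPhi L1.
have [c xE] := central_measurable hM ae ne mx; rewrite xE in x1.
have := Phi_mul zid (diagonal_center hM ae c).
apply: filterS2 x1 => w /(_ Logic.I) ->.
by rewrite mulr1.
Qed.

(** [Phi] preserves the relations [e k ^ 2 = e k], [e j e k = 0] and
    [sum_k e k = 1]. *)
Let chi_partition : \forall w \ae mu,
  exists k, chi k w = 1 /\ forall j, j != k -> chi j w = 0.
Proof.
have [_ oe se] := ae.
have h1 : \forall w \ae mu, forall j k, j != k -> chi j w * chi k w = 0.
  apply: filter_forall => j; apply: filter_forall => k.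
  have [->|jk] := eqVneq j k; first exact: nearW.
  have := Phi_mul (cproj_center (ce j)) (cproj_center (ce k)).
  rewrite (_ : (fun v => _) = fun _ => 0); last by apply/funext => v; rewrite oe.
  by apply: filterS2 Phi_zero => w -> <-.
have h2 : \forall w \ae mu, forall k, chi k w * chi k w = chi k w.
  apply: filter_forall => k.
  have := Phi_mul (cproj_center (ce k)) (cproj_center (ce k)).
  rewrite (_ : (fun v => _) = e k); last first.
    by apply/funext => v; rewrite (cproj_idem _ (ce k)).
  by apply: filterS => w <-.
have h3 : \forall w \ae mu, \sum_k chi k w = 1.
  have := Phi_diagonal (fun _ => 1); rewrite (_ : diag _ = id); last first.
    apply/funext => v; rewrite /diag_op -[RHS]se.
    by apply: eq_bigr => k _; rewrite scale1r.
  apply: filterS2 Phi_id => w -> /esym; under eq_bigr do rewrite mul1r.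
  by [].
apply: filterS3 h1 h2 h3 => w h1 h2 h3.
have [k hk] : exists k, chi k w != 0.
  apply: contrapT => h; move: h3; rewrite big1 => [/esym/eqP|k _].
    by rewrite oner_eq0.
  by apply/eqP; apply: contrapT => /negP hk; apply: h; exists k.
exists k; split=> [|j jk].
  by apply: (mulfI hk); rewrite h2 mulr1.
by apply: (mulIf hk); rewrite h1// mul0r.
Qed.

Let Phi_value c : \forall w \ae mu,
  (exists k, Phi (op_graph (diag c)) w = c k) /\
  forall k, chi k w = 1 -> Phi (op_graph (diag c)) w = c k.
Proof.
apply: filterS2 chi_partition (Phi_diagonal c) => w [k [k1 k0]] ->.
have val : \sum_j c j * chi j w = c k.
  by rewrite (bigD1 k)//= k1 mulr1 big1 ?addr0// => j jk; rewrite k0// mulr0.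
split; first by exists k.
move=> j j1; rewrite val; have [->//|jk] := eqVneq j k.
by move/eqP: j1; rewrite k0// eq_sym oner_eq0.
Qed.

(** Were the support of [chi k] negligible, [Phi] would send [e k] and 0 to the
    same class; semifiniteness then provides a part of finite measure. *)
Let atom_set k : exists A, [/\ measurable A, (0 < mu A)%E, (mu A < +oo)%E &
  \forall w \ae mu, A w -> chi k w = 1].
Proof.
have zk := cproj_center (ce k).
have [mre _] := ident_L0 hPhi (meas zk).
pose B := (fun w => complex.Re (chi k w)) @^-1` [set 1].
have mB : measurable B by rewrite -[B]setTI; apply: mre => //; exact: measurable_set1.
have chiB : \forall w \ae mu, B w -> chi k w = 1.
  apply: filterS chi_partition => w [j [j1 j0]]; rewrite /B /=.
  have [->//|jk] := eqVneq k j.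
  by rewrite j0// => /esym/eqP; rewrite oner_eq0.
have B0 : (0 < mu B)%E.
  rewrite lt0e measure_ge0 andbT; apply/eqP => muB.
  have nB : \forall w \ae mu, ~ B w by exists B; split=> // w /= /contrapT.
  have : op_graph (e k) = op_graph (fun _ => 0).
    apply: (ident_inj hPhi (meas zk) (meas (oa_0 (center_algebra hM)))).
    apply: filterS3 nB chi_partition Phi_zero => w nBw [j [j1 j0]] -> _.
    have [kj|kj] := eqVneq k j; last exact: j0.
    by case: nBw; rewrite /B /= kj j1.
  by move=> /op_graph_inj h; have [v] := ne k; rewrite h.
have [A [mA AB A0 Aoo]] := smu mB B0.
exists A; split=> //; apply: filterS chiB => w h Aw.
by apply: h; exact: AB.
Qed.

Hypothesis hE : central_extension M = op_graph @` M.

Let opnorm_small A (eps delta : R) Y : M Y -> measurable A -> 0 < eps -> 0 < delta ->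
  opnorm Y <= eps -> O_set mu M Phi A eps delta (op_graph Y).
Proof.
move=> MY mA eps0 delta0 hY; split; first exact: graph_central_extension.
have bY := oa_bounded (vn_algebra hM) MY.
pose r k := (atom_norm (e := e) Y k)%:C.
exists (op_graph (diag r)); first by apply/(central_normP hM ae ne).
have mr := diagonal_measurable hM ae r.
have bound : \forall w \ae mu, `|Phi (op_graph (diag r)) w * \1_A w| <= eps%:C.
  apply: filterS (Phi_value r) => w [[k ->] _].
  have rk0 : 0 <= r k by rewrite ler0c (atom_norm_ge0 hM ae).
  have rk : r k <= eps%:C.
    by rewrite lecR; exact: le_trans (atom_norm_le_opnorm ae k bY) hY.
  rewrite normrM (ger0_norm rk0) indicE.
  by case: (_ \in _); rewrite ?normr1 ?normr0 ?mulr1// mulr0 ler0c ltW.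
have norm_le := (Linfty_normP _ _ (ltW eps0)).2 bound.
split; first exact: (ident_L0 hPhi mr).
exists A; split=> //; first by rewrite setDv measure0 lee_fin ltW.
split; last exact: le_lt_trans norm_le (ltry eps).
by apply: L0_indic => //; exact: (ident_L0 hPhi mr).
Qed.

(** A set of positive measure on which [|Phi f| <= eps] holds almost
    everywhere contains a point where [Phi f] equals the coefficient of [f]. *)
Let small_opnorm : exists A (delta : R), [/\ measurable A, (mu A < +oo)%E, 0 < delta &
  forall (eps : R) Y, 0 < eps -> M Y ->
  O_set mu M Phi A eps delta (op_graph Y) -> opnorm Y <= eps].
Proof.
have /choice[A hA] := atom_set.
pose m k := fine (mu (A k)).
have mE k : mu (A k) = (m k)%:E.
  by have [_ ? ? _] := hA k; rewrite /m fineK// ge0_fin_numE.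
have m0 k : 0 < m k by have [_ h _ _] := hA k; rewrite -lte_fin -mE.
(* A set missing at most [delta] of the union meets each [A k] in positive
   measure. *)
pose delta := \big[Num.min/1]_k m k / 2.
have b0 : 0 < \big[Num.min/1]_k m k by apply: lt_bigmin.
have [mU Uoo] : measurable (\big[setU/set0]_k A k) /\
    (mu (\big[setU/set0]_k A k) < +oo)%E.
  elim/big_ind: _ => [|B C [mB Boo] [mC Coo]|k _].
  - by rewrite measure0.
  - split; first exact: measurableU.
    by apply: le_lt_trans (measureU2 _ mB mC) _ => //; exact: lte_add_pinfty.
  - by have [] := hA k.
exists (\big[setU/set0]_k A k), delta; split=> //; first by rewrite divr_gt0.
move=> eps Y eps0 MY [_ [f /(central_normP hM ae ne _ MY) ->]].
have bY := oa_bounded (vn_algebra hM) MY.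
set r := (fun k : 'I_n => _).
move=> [_ [B [mB _ Bd _ Bn]]].
apply: (opnorm_atoms hM ae MY (ltW eps0)) => k.
have [mA _ _ chiA] := hA k.
have BA0 : (0 < mu (B `&` A k))%E.
  rewrite lt0e measure_ge0 andbT; apply/eqP => h0.
  have : (mu (A k) <= mu (B `&` A k) + mu (A k `\` B))%E.
    rewrite {1}(_ : A k = (B `&` A k) `|` (A k `\` B)); last by rewrite setIC setUIDK.
    by apply: measureU2; [exact: measurableI|exact: measurableD].
  rewrite h0 add0e leNgt => /negP; apply.
  have : (mu (A k `\` B) <= delta%:E)%E.
    apply: le_trans Bd; apply: le_measure; rewrite ?inE.
    - exact: measurableD.
    - exact: measurableD.
    - by apply: setSD => w Aw; rewrite (bigD1 k)//=; left.
  move=> /le_lt_trans; apply; rewrite mE lte_fin /delta.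
  have := @bigmin_le _ _ _ 1 k m; move: b0; lra.
have [w [Bw Aw] [[_ hr] [chi1 hn]]] := ae_meets
  (filterI (Phi_value r) (filterI chiA ((Linfty_normP _ _ (ltW eps0)).1 Bn)))
  (measurableI _ _ mB mA) BA0.
move: hn; rewrite /= indicE mem_set// mulr1 (hr k (chi1 Aw)).
by rewrite ger0_norm ?ler0c ?(atom_norm_ge0 hM ae)// lecR.
Qed.

Lemma tc_nbhs_opnorm T : M T -> tc_nbhs mu M Phi (op_graph T) = opnorm_nbhs M T.
Proof.
move=> MT; have bM S : M S -> bounded_op S := @oa_bounded _ _ _ (vn_algebra hM) S.
apply/seteqP; split=> U.
  move=> [A [eps [delta [mA Aoo eps0 delta0 hU]]]].
  exists eps => // _ [S [MS hS] <-]; apply: hU.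
  have MY : M (fun v => S v - T v) by exact: (oa_sub (vn_algebra hM)).
  exists (op_graph (fun v => S v - T v)).
    by apply: opnorm_small => //; exact: ltW.
  rewrite strong_sum_graph; [|exact: bM|exact: bM].
  by congr op_graph; apply/funext => v; rewrite addrC subrK.
move=> [eps eps0 hU]; have [A [delta [mA Aoo delta0 hA]]] := small_opnorm.
exists A, (eps / 2), delta; split=> //; first by rewrite divr_gt0.
move=> _ [y yO <-].
have [Y MY yE] : (op_graph @` M) y by rewrite -hE; case: yO.
rewrite -yE in yO *; have hY := hA _ _ (divr_gt0 eps0 (ltr0Sn _ 1)) MY yO.
apply: hU; rewrite strong_sum_graph; [|exact: bM|exact: bM].
exists (fun v => T v + Y v) => //; split; first exact: (oa_add (vn_algebra hM)).
rewrite (_ : _ \- _ = Y); last by apply/funext => v /=; rewrite addrC addKr.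
by apply: le_lt_trans hY _; lra.
Qed.

End Topologies.

Theorem theorem3p5 (R : realType) (H : hilbertType R) (M : set (H -> H))
    (hM : von_neumann M) :
  (central_extension M = op_graph @` M <-> finite_sum_of_factors M) /\
  (central_extension M = op_graph @` M ->
   forall (d : measure_display) (Omega : measurableType d)
     (mu : {measure set Omega -> \bar R}) (Phi : oper H -> Omega -> R[i]),
     direct_sum_property mu -> semifinite mu -> identification mu M Phi ->
     forall T : H -> H, M T ->
       tc_nbhs mu M Phi (op_graph T) = opnorm_nbhs M T).
Proof.
split.
  split; first exact: finite_sum_of_factors_of_eq.
  exact: eq_of_finite_sum_of_factors.
move=> hE d Omega mu Phi _ smu hPhi T MT.
have [n [e [ae ne]]] := center_finite hM hE.
exact: (tc_nbhs_opnorm hM ae ne smu hPhi hE MT).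
Qed.
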